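(* Let $\mathcal B$ be a linearly ordered set, $N>0$ an integer, $C=C(N)$ the free Lie conformal algebra generated by $\mathcal B$ with constant locality $N$, and $L=\operatorname{Coeff}C$ its Lie algebra of coefficients, with generating set $X=\{a(n)\mid a\in\mathcal B,\ n\in\mathbb Z\}$. Let $\varphi:\Bbbk\langle X\rangle\to U(L)$ be the canonical projection, let $\mathcal H$ be the Hall set of binary trees over $X$ corresponding to the Lyndon–Shirshov words, and let $\mathcal H_{\rm term}=\{h\in\mathcal H\mid \alpha(h)\text{ is terminal}\}$. Then the set $\varphi(\lambda(\mathcal H_{\rm term}))$ is a basis of $L$.
   Context: All spaces are over a field $\Bbbk$ of characteristic $0$. $L=\operatorname{Coeff}C(N)$ is the Lie algebra presented by the generators $X=\{b(n)\mid b\in\mathcal B,\ n\in\mathbb Z\}$ and the relations $\sum_{s=0}^{N}(-1)^s\binom Ns[b(n-s),a(m+s)]=0$ for all $a,b\in\mathcal B$, $m,n\in\mathbb Z$. $\Bbbk\langle X\rangle$ is the free associative algebra with $1$ on $X$, $X^*$ the set of words in $X$, and $\varphi$ sends each generator to its image in $L\subset U(L)$. Order on $X$: $a(m)<b(n)$ iff $m<n$, or $m=n$ and $a<b$. Order on $X^*$: if $u$ is a proper prefix of $v$ then $u>v$; otherwise, for $u\neq v$, $u>v$ iff for some index $i$ one has $u_i>v_i$ and $u_j=v_j$ for all $j<i$. A nonempty word is called Lyndon–Shirshov if it is bigger than all its nonempty proper suffixes. A word in $X^*$ is called terminal if it contains no subword (pair of consecutive letters) $b(n)a(m)$ such that $n-m>N$,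 or $n-m=N$ and ($b>a$, or $b=a$ and $N$ is odd). Let $T(X)$ be the set of binary trees with leaves in $X$; $\langle x,y\rangle$ denotes the tree with left branch $x$ and right branch $y$. Define $\alpha:T(X)\to X^*$ and $\lambda:T(X)\to\Bbbk\langle X\rangle$ recursively by $\alpha(a)=\lambda(a)=a$ for $a\in X$, $\alpha(\langle x,y\rangle)=\alpha(x)\alpha(y)$ (concatenation), $\lambda(\langle x,y\rangle)=[\lambda(x),\lambda(y)]=\lambda(x)\lambda(y)-\lambda(y)\lambda(x)$. The Hall set $\mathcal H=\mathcal H_{\rm LS}\subset T(X)$ corresponding to the Lyndon–Shirshov words is defined recursively: $X\subset\mathcal H$; and $\langle x,y\rangle\in\mathcal H$ if and only if $x,y\in\mathcal H$, $\alpha(x)>\alpha(y)$, and either $x\in X$ or $x=\langle x',x''\rangle$ with $\alpha(y)\ge\alpha(x'')$. (The map $\alpha$ restricts to a bijection from $\mathcal H$ onto the set of all Lyndon–Shirshov words.) *)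

(* Defs.v *)
From HB Require Import structures.
From mathcomp Require Import all_boot all_order all_algebra finmap.
From mathcomp Require Import boolp classical_sets.
From mathcomp Require Import monalg.

Set Implicit Arguments.
Unset Strict Implicit.
Unset Printing Implicit Defensive.

Import Order.TTheory GRing.Theory Num.Theory.
Local Open Scope quotient_scope.
Local Open Scope ring_scope.

HB.mixin Record Lmodule_isLie (K : pzRingType) L of GRing.Lmodule K L := {
  lie_br : L -> L -> L;
  lie_brDl : forall x y z, lie_br (x + y) z = lie_br x z + lie_br y z;
  lie_brDr : forall x y z, lie_br x (y + z) = lie_br x y + lie_br x z;
  lie_brZl : forall (c : K) x y, lie_br (c *: x) y = c *: lie_br x y;
  lie_brZr : forall (c : K) x y, lie_br x (c *: y) = c *: lie_br x y;
  lie_br_alt : forall x, lie_br x x = 0;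
  lie_jacobi : forall x y z,
    lie_br x (lie_br y z) + lie_br y (lie_br z x) + lie_br z (lie_br x y) = 0
}.

#[short(type="lieAlgType")]
HB.structure Definition LieAlgebra (K : pzRingType) :=
  {L of GRing.Lmodule K L & Lmodule_isLie K L}.

(** The Lie algebra presented by generators [G] and relators [R]: formal Lie
    expressions in [G] modulo the least congruence that contains the axioms of
    Lie [K]-algebras and identifies every element of [R] with zero. *)
Section PresentedLieAlgebra.
Variables (K : fieldType) (G : Type).

Inductive lie_term : Type :=
| LGen of G
| LZero
| LOpp of lie_term
| LAdd of lie_term & lie_term
| LScale of K & lie_term
| LBr of lie_term & lie_term.

HB.instance Definition _ := gen_eqMixin lie_term.
HB.instance Definition _ := gen_choiceMixin lie_term.

Variable R : lie_term -> Prop.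

Inductive lie_cong : lie_term -> lie_term -> Prop :=
| LC_rel t of R t : lie_cong t LZero
| LC_refl t : lie_cong t t
| LC_sym s t of lie_cong s t : lie_cong t s
| LC_trans s t u of lie_cong s t & lie_cong t u : lie_cong s u
| LC_opp s s' of lie_cong s s' : lie_cong (LOpp s) (LOpp s')
| LC_add s s' t t' of lie_cong s s' & lie_cong t t' :
    lie_cong (LAdd s t) (LAdd s' t')
| LC_scale c s s' of lie_cong s s' : lie_cong (LScale c s) (LScale c s')
| LC_br s s' t t' of lie_cong s s' & lie_cong t t' :
    lie_cong (LBr s t) (LBr s' t')
| LC_addA s t u : lie_cong (LAdd s (LAdd t u)) (LAdd (LAdd s t) u)
| LC_addC s t : lie_cong (LAdd s t) (LAdd t s)
| LC_add0 s : lie_cong (LAdd LZero s) s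
| LC_addN s : lie_cong (LAdd (LOpp s) s) LZero
| LC_scaleA a b s : lie_cong (LScale a (LScale b s)) (LScale (a * b) s)
| LC_scale1 s : lie_cong (LScale 1 s) s
| LC_scaleDr c s t :
    lie_cong (LScale c (LAdd s t)) (LAdd (LScale c s) (LScale c t))
| LC_scaleDl a b s :
    lie_cong (LScale (a + b) s) (LAdd (LScale a s) (LScale b s))
| LC_brDl s t u : lie_cong (LBr (LAdd s t) u) (LAdd (LBr s u) (LBr t u))
| LC_brDr s t u : lie_cong (LBr s (LAdd t u)) (LAdd (LBr s t) (LBr s u))
| LC_brZl c s t : lie_cong (LBr (LScale c s) t) (LScale c (LBr s t))
| LC_brZr c s t : lie_cong (LBr s (LScale c t)) (LScale c (LBr s t))
| LC_alt s : lie_cong (LBr s s) LZero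
| LC_jacobi s t u :
    lie_cong (LAdd (LAdd (LBr s (LBr t u)) (LBr t (LBr u s)))
                   (LBr u (LBr s t))) LZero.

Definition lie_congb (s t : lie_term) : bool := `[< lie_cong s t >].

Lemma lie_congb_refl : reflexive lie_congb.
Proof. by move=> s; apply/asboolP; exact: LC_refl. Qed.

Lemma lie_congb_sym : symmetric lie_congb.
Proof. by move=> s t; apply/asboolP/asboolP; exact: LC_sym. Qed.

Lemma lie_congb_trans : transitive lie_congb.
Proof.
by move=> t s u /asboolP st /asboolP tu; apply/asboolP; exact: LC_trans st tu.
Qed.

Canonical lie_cong_equiv :=
  EquivRel lie_congb lie_congb_refl lie_congb_sym lie_congb_trans.

Definition pres_lie := {eq_quot lie_cong_equiv}.
HB.instance Definition _ := Choice.on pres_lie.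

Implicit Types x y z : pres_lie.

Definition lie_class (t : lie_term) : pres_lie :=
  \pi_({eq_quot lie_cong_equiv}) t.

Lemma lie_classP s t : lie_class s = lie_class t <-> lie_cong s t.
Proof. by split=> [/eqmodP/asboolP|st]; last by apply/eqmodP/asboolP. Qed.

Lemma lie_classK x : lie_class (repr x) = x.
Proof. exact: reprK. Qed.

Lemma lie_classW (P : pres_lie -> Prop) :
  (forall t, P (lie_class t)) -> forall x, P x.
Proof. by move=> Pt x; rewrite -(lie_classK x). Qed.

Lemma lie_repr t : lie_cong (repr (lie_class t)) t.
Proof. by apply/lie_classP; rewrite lie_classK. Qed.

Definition pl_zero := lie_class LZero.
Definition pl_opp x := lie_class (LOpp (repr x)).
Definition pl_add x y := lie_class (LAdd (repr x) (repr y)).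
Definition pl_scale c x := lie_class (LScale c (repr x)).
Definition pl_br x y := lie_class (LBr (repr x) (repr y)).

Lemma pl_oppE t : pl_opp (lie_class t) = lie_class (LOpp t).
Proof. by apply/lie_classP/LC_opp/lie_repr. Qed.

Lemma pl_addE s t : pl_add (lie_class s) (lie_class t) = lie_class (LAdd s t).
Proof. by apply/lie_classP/LC_add; exact: lie_repr. Qed.

Lemma pl_scaleE c t : pl_scale c (lie_class t) = lie_class (LScale c t).
Proof. by apply/lie_classP/LC_scale/lie_repr. Qed.

Lemma pl_brE s t : pl_br (lie_class s) (lie_class t) = lie_class (LBr s t).
Proof. by apply/lie_classP/LC_br; exact: lie_repr. Qed.

Let plE := (pl_oppE, pl_addE, pl_scaleE, pl_brE).

Lemma pl_addA : associative pl_add.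
Proof.
move=> x y z; elim/lie_classW: x => x; elim/lie_classW: y => y;
  elim/lie_classW: z => z.
rewrite !plE.
exact/lie_classP/LC_addA.
Qed.

Lemma pl_addC : commutative pl_add.
Proof.
move=> x y; elim/lie_classW: x => x; elim/lie_classW: y => y; rewrite !plE.
exact/lie_classP/LC_addC.
Qed.

Lemma pl_add0 : left_id pl_zero pl_add.
Proof.
move=> x; elim/lie_classW: x => x.
rewrite !plE.
exact/lie_classP/LC_add0.
Qed.

Lemma pl_addN : left_inverse pl_zero pl_opp pl_add.
Proof.
move=> x; elim/lie_classW: x => x.
rewrite !plE.
exact/lie_classP/LC_addN.
Qed.

HB.instance Definition _ :=
  GRing.isZmodule.Build pres_lie pl_addA pl_addC pl_add0 pl_addN.

Lemma pl_scaleA a b x : pl_scale a (pl_scale b x) = pl_scale (a * b) x.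
Proof. elim/lie_classW: x => x; rewrite !plE; exact/lie_classP/LC_scaleA. Qed.

Lemma pl_scale1 : left_id 1 pl_scale.
Proof.
move=> x; elim/lie_classW: x => x.
rewrite !plE.
exact/lie_classP/LC_scale1.
Qed.

Lemma pl_scaleDr : right_distributive pl_scale +%R.
Proof.
move=> c x y; elim/lie_classW: x => x; elim/lie_classW: y => y.
rewrite /GRing.add /= !plE.
exact/lie_classP/LC_scaleDr.
Qed.

Lemma pl_scaleDl x : {morph pl_scale^~ x : a b / a + b}.
Proof.
move=> a b; elim/lie_classW: x => x; rewrite [RHS]/GRing.add /= !plE.
exact/lie_classP/LC_scaleDl.
Qed.

HB.instance Definition _ := GRing.Zmodule_isLmodule.Build K pres_lie
  pl_scaleA pl_scale1 pl_scaleDr pl_scaleDl.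

Lemma lie_class0 : lie_class LZero = 0.
Proof. by []. Qed.

Lemma lie_classN t : lie_class (LOpp t) = - lie_class t.
Proof. by rewrite -pl_oppE. Qed.

Lemma lie_classD s t : lie_class (LAdd s t) = lie_class s + lie_class t.
Proof. by rewrite -pl_addE. Qed.

Lemma lie_classZ c t : lie_class (LScale c t) = c *: lie_class t.
Proof. by rewrite -pl_scaleE. Qed.

Lemma pl_brDl x y z : pl_br (x + y) z = pl_br x z + pl_br y z.
Proof.
elim/lie_classW: x => x; elim/lie_classW: y => y; elim/lie_classW: z => z.
rewrite !(pl_brE, =^~ lie_classD).
exact/lie_classP/LC_brDl.
Qed.

Lemma pl_brDr x y z : pl_br x (y + z) = pl_br x y + pl_br x z.
Proof.
elim/lie_classW: x => x; elim/lie_classW: y => y; elim/lie_classW: z => z.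
rewrite !(pl_brE, =^~ lie_classD).
exact/lie_classP/LC_brDr.
Qed.

Lemma pl_brZl c x y : pl_br (c *: x) y = c *: pl_br x y.
Proof.
elim/lie_classW: x => x; elim/lie_classW: y => y.
rewrite -[c *: lie_class _]lie_classZ !pl_brE -lie_classZ.
exact/lie_classP/LC_brZl.
Qed.

Lemma pl_brZr c x y : pl_br x (c *: y) = c *: pl_br x y.
Proof.
elim/lie_classW: x => x; elim/lie_classW: y => y.
rewrite -[c *: lie_class _]lie_classZ !pl_brE -lie_classZ.
exact/lie_classP/LC_brZr.
Qed.

Lemma pl_br_alt x : pl_br x x = 0.
Proof. elim/lie_classW: x => x; rewrite pl_brE; exact/lie_classP/LC_alt. Qed.

Lemma pl_jacobi x y z :
  pl_br x (pl_br y z) + pl_br y (pl_br z x) + pl_br z (pl_br x y) = 0.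
Proof.
elim/lie_classW: x => x; elim/lie_classW: y => y; elim/lie_classW: z => z.
rewrite !(pl_brE, =^~ lie_classD).
exact/lie_classP/LC_jacobi.
Qed.

HB.instance Definition _ := Lmodule_isLie.Build K pres_lie
  pl_brDl pl_brDr pl_brZl pl_brZr pl_br_alt pl_jacobi.

Lemma lie_class_br s t :
  lie_class (LBr s t) = lie_br (lie_class s) (lie_class t).
Proof. by rewrite -pl_brE. Qed.

Definition lie_gen (g : G) : pres_lie := lie_class (LGen g).

End PresentedLieAlgebra.

Arguments LZero {K G}.
Arguments LGen {K G}.

(** The universal enveloping algebra U(L): formal expressions in the elements
    of [L] modulo the least congruence that contains the axioms of associative
    unital [K]-algebras and makes the inclusion of [L] a linear map turning
    brackets into commutators. *)
Section EnvelopingAlgebra.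
Variables (K : fieldType) (L : lieAlgType K).

Inductive env_term : Type :=
| EIn of L
| EZero
| EOne
| EOpp of env_term
| EAdd of env_term & env_term
| EScale of K & env_term
| EMul of env_term & env_term.

HB.instance Definition _ := gen_eqMixin env_term.
HB.instance Definition _ := gen_choiceMixin env_term.

Inductive env_cong : env_term -> env_term -> Prop :=
| EC_inD x y : env_cong (EIn (x + y)) (EAdd (EIn x) (EIn y))
| EC_inZ c x : env_cong (EIn (c *: x)) (EScale c (EIn x))
| EC_in_br x y : env_cong (EIn (lie_br x y))
    (EAdd (EMul (EIn x) (EIn y)) (EOpp (EMul (EIn y) (EIn x))))
| EC_refl t : env_cong t t
| EC_sym s t of env_cong s t : env_cong t s
| EC_trans s t u of env_cong s t & env_cong t u : env_cong s u
| EC_opp s s' of env_cong s s' : env_cong (EOpp s) (EOpp s')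
| EC_add s s' t t' of env_cong s s' & env_cong t t' :
    env_cong (EAdd s t) (EAdd s' t')
| EC_scale c s s' of env_cong s s' : env_cong (EScale c s) (EScale c s')
| EC_mul s s' t t' of env_cong s s' & env_cong t t' :
    env_cong (EMul s t) (EMul s' t')
| EC_addA s t u : env_cong (EAdd s (EAdd t u)) (EAdd (EAdd s t) u)
| EC_addC s t : env_cong (EAdd s t) (EAdd t s)
| EC_add0 s : env_cong (EAdd EZero s) s
| EC_addN s : env_cong (EAdd (EOpp s) s) EZero
| EC_scaleA a b s : env_cong (EScale a (EScale b s)) (EScale (a * b) s)
| EC_scale1 s : env_cong (EScale 1 s) s
| EC_scaleDr c s t :
    env_cong (EScale c (EAdd s t)) (EAdd (EScale c s) (EScale c t))
| EC_scaleDl a b s :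
    env_cong (EScale (a + b) s) (EAdd (EScale a s) (EScale b s))
| EC_mulA s t u : env_cong (EMul s (EMul t u)) (EMul (EMul s t) u)
| EC_mul1l s : env_cong (EMul EOne s) s
| EC_mul1r s : env_cong (EMul s EOne) s
| EC_mulDl s t u : env_cong (EMul (EAdd s t) u) (EAdd (EMul s u) (EMul t u))
| EC_mulDr s t u : env_cong (EMul s (EAdd t u)) (EAdd (EMul s t) (EMul s u))
| EC_mulZl c s t : env_cong (EScale c (EMul s t)) (EMul (EScale c s) t)
| EC_mulZr c s t : env_cong (EScale c (EMul s t)) (EMul s (EScale c t)).

Definition env_congb (s t : env_term) : bool := `[< env_cong s t >].

Lemma env_congb_refl : reflexive env_congb.
Proof. by move=> s; apply/asboolP; exact: EC_refl. Qed.

Lemma env_congb_sym : symmetric env_congb.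
Proof. by move=> s t; apply/asboolP/asboolP; exact: EC_sym. Qed.

Lemma env_congb_trans : transitive env_congb.
Proof.
by move=> t s u /asboolP st /asboolP tu; apply/asboolP; exact: EC_trans st tu.
Qed.

Canonical env_cong_equiv :=
  EquivRel env_congb env_congb_refl env_congb_sym env_congb_trans.

Definition env_alg := {eq_quot env_cong_equiv}.
HB.instance Definition _ := Choice.on env_alg.

Implicit Types x y z : env_alg.

Definition env_class (t : env_term) : env_alg :=
  \pi_({eq_quot env_cong_equiv}) t.

Lemma env_classP s t : env_class s = env_class t <-> env_cong s t.
Proof. by split=> [/eqmodP/asboolP|st]; last by apply/eqmodP/asboolP. Qed.

Lemma env_classK x : env_class (repr x) = x.
Proof. exact: reprK. Qed.

Lemma env_classW (P : env_alg -> Prop) :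
  (forall t, P (env_class t)) -> forall x, P x.
Proof. by move=> Pt x; rewrite -(env_classK x). Qed.

Lemma env_repr t : env_cong (repr (env_class t)) t.
Proof. by apply/env_classP; rewrite env_classK. Qed.

Definition ea_zero := env_class EZero.
Definition ea_one := env_class EOne.
Definition ea_opp x := env_class (EOpp (repr x)).
Definition ea_add x y := env_class (EAdd (repr x) (repr y)).
Definition ea_scale c x := env_class (EScale c (repr x)).
Definition ea_mul x y := env_class (EMul (repr x) (repr y)).

Lemma ea_oppE t : ea_opp (env_class t) = env_class (EOpp t).
Proof. by apply/env_classP/EC_opp/env_repr. Qed.

Lemma ea_addE s t : ea_add (env_class s) (env_class t) = env_class (EAdd s t).
Proof. by apply/env_classP/EC_add; exact: env_repr. Qed.

Lemma ea_scaleE c t : ea_scale c (env_class t) = env_class (EScale c t).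
Proof. by apply/env_classP/EC_scale/env_repr. Qed.

Lemma ea_mulE s t : ea_mul (env_class s) (env_class t) = env_class (EMul s t).
Proof. by apply/env_classP/EC_mul; exact: env_repr. Qed.

Let eaE := (ea_oppE, ea_addE, ea_scaleE, ea_mulE).

Lemma ea_addA : associative ea_add.
Proof.
move=> x y z; elim/env_classW: x => x; elim/env_classW: y => y;
  elim/env_classW: z => z.
rewrite !eaE.
exact/env_classP/EC_addA.
Qed.

Lemma ea_addC : commutative ea_add.
Proof.
move=> x y; elim/env_classW: x => x; elim/env_classW: y => y; rewrite !eaE.
exact/env_classP/EC_addC.
Qed.

Lemma ea_add0 : left_id ea_zero ea_add.
Proof.
move=> x; elim/env_classW: x => x.
rewrite !eaE.
exact/env_classP/EC_add0.
Qed.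

Lemma ea_addN : left_inverse ea_zero ea_opp ea_add.
Proof.
move=> x; elim/env_classW: x => x.
rewrite !eaE.
exact/env_classP/EC_addN.
Qed.

HB.instance Definition _ :=
  GRing.isZmodule.Build env_alg ea_addA ea_addC ea_add0 ea_addN.

Lemma ea_mulA : associative ea_mul.
Proof.
move=> x y z; elim/env_classW: x => x; elim/env_classW: y => y;
  elim/env_classW: z => z.
rewrite !eaE.
exact/env_classP/EC_mulA.
Qed.

Lemma ea_mul1l : left_id ea_one ea_mul.
Proof.
move=> x; elim/env_classW: x => x.
rewrite !eaE.
exact/env_classP/EC_mul1l.
Qed.

Lemma ea_mul1r : right_id ea_one ea_mul.
Proof.
move=> x; elim/env_classW: x => x.
rewrite !eaE.
exact/env_classP/EC_mul1r.
Qed.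

Lemma ea_mulDl : left_distributive ea_mul +%R.
Proof.
move=> x y z; elim/env_classW: x => x; elim/env_classW: y => y;
  elim/env_classW: z => z.
rewrite /GRing.add /= !eaE; exact/env_classP/EC_mulDl.
Qed.

Lemma ea_mulDr : right_distributive ea_mul +%R.
Proof.
move=> x y z; elim/env_classW: x => x; elim/env_classW: y => y;
  elim/env_classW: z => z.
rewrite /GRing.add /= !eaE; exact/env_classP/EC_mulDr.
Qed.

(* The augmentation U(L) -> K shows that 1 != 0 in U(L). *)
Fixpoint env_aug (t : env_term) : K :=
  match t with
  | EIn _ => 0
  | EZero => 0
  | EOne => 1
  | EOpp s => - env_aug s
  | EAdd s u => env_aug s + env_aug u
  | EScale c s => c * env_aug s
  | EMul s u => env_aug s * env_aug u
  end.

Lemma env_aug_cong s t : env_cong s t -> env_aug s = env_aug t.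
Proof.
elim=> //= *; rewrite ?(addr0, mulr0, oppr0, add0r, mul1r, mulr1, addNr) //.
- by congruence.
- by congruence.
- by congruence.
- by congruence.
- by congruence.
- by rewrite addrA.
- by rewrite addrC.
- by rewrite mulrA.
- by rewrite mulrDr.
- by rewrite mulrDl.
- by rewrite mulrA.
- by rewrite mulrDl.
- by rewrite mulrDr.
- by rewrite mulrA.
- by rewrite mulrCA.
Qed.

Lemma ea_oner_neq0 : ea_one != 0.
Proof.
by apply/eqP => /env_classP/env_aug_cong/eqP; rewrite /= oner_eq0.
Qed.

HB.instance Definition _ := GRing.Zmodule_isNzRing.Build env_alg
  ea_mulA ea_mul1l ea_mul1r ea_mulDl ea_mulDr ea_oner_neq0.

Lemma ea_scaleA a b x : ea_scale a (ea_scale b x) = ea_scale (a * b) x.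
Proof. elim/env_classW: x => x; rewrite !eaE; exact/env_classP/EC_scaleA. Qed.

Lemma ea_scale1 : left_id 1 ea_scale.
Proof.
move=> x; elim/env_classW: x => x.
rewrite !eaE.
exact/env_classP/EC_scale1.
Qed.

Lemma ea_scaleDr : right_distributive ea_scale +%R.
Proof.
move=> c x y; elim/env_classW: x => x; elim/env_classW: y => y.
rewrite /GRing.add /= !eaE.
exact/env_classP/EC_scaleDr.
Qed.

Lemma ea_scaleDl x : {morph ea_scale^~ x : a b / a + b}.
Proof.
move=> a b; elim/env_classW: x => x; rewrite [RHS]/GRing.add /= !eaE.
exact/env_classP/EC_scaleDl.
Qed.

HB.instance Definition _ := GRing.Zmodule_isLmodule.Build K env_alg
  ea_scaleA ea_scale1 ea_scaleDr ea_scaleDl.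

Lemma ea_scaleAl c x y : c *: (x * y) = (c *: x) * y.
Proof.
elim/env_classW: x => x; elim/env_classW: y => y.
rewrite /GRing.scale /GRing.mul /= !eaE.
exact/env_classP/EC_mulZl.
Qed.

HB.instance Definition _ := GRing.Lmodule_isLalgebra.Build K env_alg ea_scaleAl.

Lemma ea_scaleAr c x y : c *: (x * y) = x * (c *: y).
Proof.
elim/env_classW: x => x; elim/env_classW: y => y.
rewrite /GRing.scale /GRing.mul /= !eaE.
exact/env_classP/EC_mulZr.
Qed.

HB.instance Definition _ := GRing.Lalgebra_isAlgebra.Build K env_alg ea_scaleAr.

Definition env_in (l : L) : env_alg := env_class (EIn l).

Lemma env_classN t : env_class (EOpp t) = - env_class t.
Proof. by rewrite -ea_oppE. Qed.

Lemma env_classD s t : env_class (EAdd s t) = env_class s + env_class t.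
Proof. by rewrite -ea_addE. Qed.

Lemma env_classZ c t : env_class (EScale c t) = c *: env_class t.
Proof. by rewrite -ea_scaleE. Qed.

Lemma env_classM s t : env_class (EMul s t) = env_class s * env_class t.
Proof. by rewrite -ea_mulE. Qed.

Lemma env_inD (x y : L) : env_in (x + y) = env_in x + env_in y.
Proof. rewrite -env_classD; exact/env_classP/EC_inD. Qed.

Lemma env_inZ c (x : L) : env_in (c *: x) = c *: env_in x.
Proof. rewrite -env_classZ; exact/env_classP/EC_inZ. Qed.

Lemma env_in_br (x y : L) :
  env_in (lie_br x y) = env_in x * env_in y - env_in y * env_in x.
Proof.
rewrite -!env_classM -env_classN -env_classD; exact/env_classP/EC_in_br.
Qed.

End EnvelopingAlgebra.

Local Open Scope classical_set_scope.

Section Basis.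
Variables (K : fieldType) (V : lmodType K).
Implicit Types S : set V.

Definition lin_indep S := forall (s : seq V) (c : V -> K),
  uniq s -> {in s, forall v, S v} -> \sum_(v <- s) c v *: v = 0 ->
  {in s, forall v, c v = 0}.

Definition spanning S := forall x : V, exists (s : seq V) (c : V -> K),
  {in s, forall v, S v} /\ x = \sum_(v <- s) c v *: v.

Definition is_basis S := lin_indep S /\ spanning S.

End Basis.

Inductive tree (T : Type) : Type :=
| Leaf of T
| Node of tree T & tree T.

(** The generator [a(n)] is the pair [(n, a)], so that the lexicographic order
    compares indices first. *)
Definition gen (d : Order.disp_t) (B : orderType d) := (int *l B)%type.
HB.instance Definition _ d (B : orderType d) := Order.Total.on (gen B).

Definition mkgen d (B : orderType d) (a : B) (n : int) : gen B := (n, a).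

Lemma gen_lt d (B : orderType d) (a b : B) (m n : int) :
  (mkgen a m < mkgen b n)%O = (m < n) || (m == n) && (a < b)%O.
Proof.
have -> : (mkgen a m < mkgen b n)%O = (m <= n) &&
  ((n <= m) ==> (a < b)%O) by [].
by case: (ltgtP m n).
Qed.

Section Words.
Variables (d : Order.disp_t) (B : orderType d) (N : nat).
Local Notation X := (gen B).
Implicit Types (u v : seq X) (t : tree X).

(** Unlike in [seqlexi], a proper prefix of a word is larger than the word. *)
Fixpoint word_gt u v : bool :=
  match u, v with
  | [::], [::] => false
  | [::], _ :: _ => true
  | _ :: _, [::] => false
  | x :: u', y :: v' => (x > y)%O || (x == y) && word_gt u' v'
  end.

Lemma word_gtP u v :
  word_gt u v <->
  (exists y w, v = u ++ y :: w) \/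
  (exists p x y u' v', [/\ u = p ++ x :: u', v = p ++ y :: v' & (x > y)%O]).
Proof.
split.
  elim: u v => [|x u IHu] [|y v] //=; first by left; exists y, v.
  case/orP=> [yx|/andP[/eqP <- /IHu[[z [w ->]]|]]].
  - by right; exists [::], x, y, u, v.
  - by left; exists z, w.
  - case=> p [a [b [u' [v' [-> -> ba]]]]].
    by right; exists (x :: p), a, b, u', v'.
case=> [[y [w ->]]|[p [x [y [u' [v' [-> -> yx]]]]]]].
  by elim: u => //= x u ->; rewrite eqxx orbT.
by elim: p => /= [|z p ->]; rewrite ?yx // eqxx orbT.
Qed.

Definition word_ge u v := (u == v) || word_gt u v.

Definition bad_pair (x y : X) : bool :=
  let: (n, b) := x in let: (m, a) := y in
  (n - m > N%:Z) ||
  (n - m == N%:Z) && ((b > a)%O || (b == a) && odd N).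

(* [sorted] tests the relation on consecutive letters only; it need not be
   transitive. *)
Definition terminal u : bool := sorted (fun x y => ~~ bad_pair x y) u.

Fixpoint alpha t : seq X :=
  match t with
  | Leaf x => [:: x]
  | Node t1 t2 => alpha t1 ++ alpha t2
  end.

Fixpoint hall t : bool :=
  match t with
  | Leaf _ => true
  | Node t1 t2 =>
      [&& hall t1, hall t2, word_gt (alpha t1) (alpha t2) &
          match t1 with
          | Leaf _ => true
          | Node _ t12 => word_ge (alpha t2) (alpha t12)
          end]
  end.

Definition hall_term : set (tree X) := [set h | hall h && terminal (alpha h)].

End Words.

Section CoefficientAlgebra.
Variables (K : fieldType) (d : Order.disp_t) (B : orderType d) (N : nat).
Local Notation X := (gen B).

(** K<X>, the free associative algebra, is the algebra of the free monoid. *)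
Definition free_alg := {malg K[{fmonom X}]}.
HB.instance Definition _ := GRing.Lalgebra.on free_alg.

Fixpoint lambda (t : tree X) : free_alg :=
  match t with
  | Leaf x => << fmu x >>
  | Node t1 t2 => lambda t1 * lambda t2 - lambda t2 * lambda t1
  end.

Definition locality_sum (b a : B) (n m : int) : lie_term K X :=
  \big[@LAdd K X/LZero]_(0 <= s < N.+1)
    LScale ((-1) ^+ s * 'C(N, s)%:R)
      (LBr (LGen (mkgen b (n - s%:Z))) (LGen (mkgen a (m + s%:Z)))).

Definition locality_rel : lie_term K X -> Prop :=
  [set t | exists b a n m, t = locality_sum b a n m].

(** L = Coeff C(N). *)
Definition coeff_lie : lieAlgType K := pres_lie locality_rel.

Definition U_L := env_alg coeff_lie.
HB.instance Definition _ := GRing.Algebra.on U_L.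

Definition phi_word (w : {fmonom X}) : U_L :=
  \prod_(x <- w) env_in (lie_gen locality_rel x : coeff_lie).

Lemma phi_word_morphism : mmorphism phi_word.
Proof.
split=> [u v|]; rewrite /phi_word; last by rewrite fm1 big_nil.
by rewrite fmM big_cat.
Qed.

HB.instance Definition _ :=
  isMultiplicative.Build {fmonom X} U_L phi_word phi_word_morphism.

Definition phi (p : free_alg) : U_L := mmap (in_alg U_L) phi_word p.

Lemma phi_gen (x : X) :
  phi << fmu x >> = env_in (lie_gen locality_rel x : coeff_lie).
Proof.
by rewrite /phi mmapU /= scale1r mul1r /phi_word fmU big_cons big_nil mulr1.
Qed.

Lemma phi_linear : linear phi.
Proof.
by move=> c p q; rewrite /phi mmapD mmapZ /= -scalerAl mul1r.
Qed.

Lemma phi_monoid_morphism : monoid_morphism phi.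
Proof.
have [|phiM phi1] := @commr_mmap_is_multiplicative _ _ _ (in_alg U_L) phi_word.
  by move=> *; rewrite /GRing.comm /= -scalerAl -scalerAr mul1r mulr1.
by split.
Qed.

End CoefficientAlgebra.

(* Main.v *)
Require Import Defs.
From HB Require Import structures.
From mathcomp Require Import all_boot all_order all_algebra finmap.
From mathcomp Require Import boolp classical_sets.
From mathcomp Require Import monalg zify.

Set Implicit Arguments.
Unset Strict Implicit.
Unset Printing Implicit Defensive.

Import Order.TTheory GRing.Theory Num.Theory.
Local Open Scope ring_scope.

(** In the degree-lexicographic order the locality relators have the bad pairs as
    leading words. Their overlaps are resolved by one syzygy: the Jacobi identity for
    three fields multiplied by (z1 - z2)^N (z1 - z3)^N (z2 - z3)^N is a combination of
    relators in which only the two relators of the overlap reach the top word. Hence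
    the leading word of every nonzero element of the ideal contains a bad pair, and
    since lambda h has leading word alpha h, the images of the terminal Hall trees are
    linearly independent in U(L).

    Conversely, let alpha h contain a bad pair xy. The Hall condition forces x to be a
    leaf of h that is bracketed with a tree starting with y and with letters at most y.
    Rebracketing so that [x, y] becomes a subtree and replacing it with the relator
    yields an element of the Lie ideal with the same leading word alpha h. Subtracting
    it and rewriting in the Hall basis expresses h through Hall trees with smaller
    words. So the terminal Hall trees span L; with the independence in U(L) this also
    shows that L embeds in U(L). *)

(** * Linear spans and words *)

(** Because indices range over all integers, neither word order is well-founded, not even on words
    of one length. Every induction on words therefore takes place over a finite set [F] of letters,
    and relators of bad pairs stay inside [F] once [F] contains all intermediate indices. Two orders
    are needed. Hall trees are governed by [word_gt], which is not compatible with products; leading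
    words need [wlt]. The two agree on words of equal length, and this covers the comparison that
    decides the leading word of a commutator, between a product of two words and the swapped
    product. Injectivity of L -> U(L) comes out only at the end, so an element of L has no leading
    word of its own. The spanning argument works with pairs in L x A, and the independence argument
    evaluates U(L) back into A modulo the ideal of relators. Characteristic zero enters because
    leading coefficients and multiplicities in the overlaps are positive integers that have to be
    inverted. *)

Section Span.
Variables (K : fieldType) (V : lmodType K).
Implicit Types (G H : V -> Prop) (x y g : V).

Inductive lspan G : V -> Prop :=
| lspan0 : lspan G 0
| lspanDZ c g x of G g & lspan G x : lspan G (c *: g + x).

Lemma lspan_gen G g : G g -> lspan G g.
Proof. by move=> Gg; rewrite -[g]scale1r -[_ *: _]addr0; apply/lspanDZ/lspan0. Qed.

Lemma lspanD G x y : lspan G x -> lspan G y -> lspan G (x + y).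
Proof.
move=> + Gy; elim=> [|c g z Gg _ IH]; first by rewrite add0r.
by rewrite -addrA; apply: lspanDZ.
Qed.

Lemma lspanZ G c x : lspan G x -> lspan G (c *: x).
Proof.
elim=> [|a g z Gg _ IH]; first by rewrite scaler0; apply: lspan0.
by rewrite scalerDr scalerA; apply: lspanDZ.
Qed.

Lemma lspanN G x : lspan G x -> lspan G (- x).
Proof. by rewrite -scaleN1r; apply: lspanZ. Qed.

Lemma lspanB G x y : lspan G x -> lspan G y -> lspan G (x - y).
Proof. by move=> Gx Gy; apply/lspanD/lspanN. Qed.

Lemma lspan_sum (I : eqType) (r : seq I) (P : pred I) (F : I -> V) G :
  (forall i, i \in r -> P i -> lspan G (F i)) -> lspan G (\sum_(i <- r | P i) F i).
Proof.
move=> GF; rewrite big_seq_cond.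
by elim/big_ind: _ => [|x y|i /andP[ri Pi]]; [apply: lspan0|apply: lspanD|apply: GF].
Qed.

Lemma lspan_sub G H x : (forall g, G g -> lspan H g) -> lspan G x -> lspan H x.
Proof.
move=> GH; elim=> [|c g z /GH Hg _ IH]; first exact: lspan0.
by apply: lspanD IH; apply: lspanZ.
Qed.

Lemma lspan_repr (T : eqType) (e : T -> V) (P : T -> Prop) x :
    lspan (fun g => exists2 t, P t & g = e t) x ->
  exists s (c : T -> K),
    [/\ uniq s, {in s, forall t, P t} & x = \sum_(t <- s) c t *: e t].
Proof.
elim=> [|a _ z [t Pt ->] _ [s [c [us Ps ->]]]].
  by exists [::], (fun=> 0); split=> //; rewrite big_nil.
have [ts|ts] := boolP (t \in s).
  exists s, (fun u => if u == t then a + c u else c u); split=> //.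
  rewrite !(bigD1_seq t) //= eqxx addrA -scalerDl; congr (_ + _).
  by apply: eq_bigr => i /negPf->.
exists (t :: s), (fun u => if u == t then a else c u); split=> /=.
- by rewrite ts.
- by move=> u; rewrite inE => /predU1P[->|/Ps].
rewrite big_cons eqxx; congr (_ + _); apply: eq_big_seq => u us'.
by case: eqP us' ts => // -> ->.
Qed.

End Span.

Lemma lspan_map (K : fieldType) (V W : lmodType K) (G : V -> Prop) (H : W -> Prop)
    (f : V -> W) : f 0 = 0 -> (forall c x y, f (c *: x + y) = c *: f x + f y) ->
  (forall g, G g -> lspan H (f g)) -> forall x, lspan G x -> lspan H (f x).
Proof.
move=> f0 fD GH x; elim=> [|c g z /GH Hg _ IH]; first by rewrite f0; apply: lspan0.
by rewrite fD; apply: lspanD IH; apply: lspanZ.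
Qed.

Section FiniteInduction.
Variable T : eqType.
Implicit Types (s : seq T) (R : rel T).

Lemma count_le (a b : pred T) s :
  {in s, forall y, a y -> b y} -> (count a s <= count b s)%N.
Proof.
move=> ab; rewrite -!sum1_count [leqRHS](bigID a) /= -[leqLHS]addn0.
rewrite leq_add // big_seq_cond [leqRHS]big_seq_cond.
rewrite (eq_bigl (fun y => (y \in s) && (b y && a y))) // => y.
by have := ab y; case: (y \in s) (a y) (b y) => [] [] [] // /(_ isT isT).
Qed.

Lemma count_lt (a b : pred T) s x : {in s, forall y, a y -> b y} ->
  x \in s -> b x -> ~~ a x -> (count a s < count b s)%N.
Proof.
move=> ab xs bx ax; rewrite -[ltnRHS]size_filter -(count_predC a) !count_filter.
rewrite -addn1 leq_add //.
  by apply: count_le => y ys /[dup] ay /(ab _ ys) /= ->; rewrite ay.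
by rewrite -has_count; apply/hasP; exists x; rewrite //= ax.
Qed.

Lemma finite_wf_ind R s (P : T -> Prop) : irreflexive R -> transitive R ->
  (forall x, x \in s -> (forall y, y \in s -> R y x -> P y) -> P x) ->
  forall x, x \in s -> P x.
Proof.
move=> Rirr Rtr IH x; have [n] := ubnP (count (R^~ x) s).
elim: n x => // n IHn x cx xs; apply: IH => // y ys Ryx; apply: IHn => //.
apply: leq_trans (_ : count (R^~ x) s <= n)%N; last by rewrite -ltnS.
by apply: (count_lt (x := y)) => [z _ Rzy||//|]; [apply: Rtr Ryx| |rewrite Rirr].
Qed.

End FiniteInduction.

(** * The Lyndon order and the degree-lexicographic order on words *)

Section WordOrder.
Variables (d : Order.disp_t) (B : orderType d).
Local Notation X := (gen B).
Implicit Types (u v w s t : seq X) (x y : X).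

Lemma word_gt_irr u : word_gt u u = false.
Proof. by elim: u => //= x u ->; rewrite ltxx andbF. Qed.

Lemma word_gt_trans v u w : word_gt u v -> word_gt v w -> word_gt u w.
Proof.
elim: u v w => [|x u IH] [|y v] [|z w] //=.
case/orP=> [yx|/andP[/eqP<- uv]] /orP[zy|/andP[/eqP<- vw]].
- by rewrite (lt_trans zy yx).
- by rewrite yx.
- by rewrite zy.
- by rewrite eqxx (IH _ _ uv vw) orbT.
Qed.

Lemma word_gt_total u v : [|| u == v, word_gt u v | word_gt v u].
Proof.
elim: u v => [|x u IH] [|y v] //=; rewrite eqseq_cons.
by case: (ltgtP x y) => //= _; rewrite IH.
Qed.

Lemma word_gt_asym u v : word_gt u v -> word_gt v u = false.
Proof.
move=> uv; apply/negP => vu.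
by have := word_gt_trans uv vu; rewrite word_gt_irr.
Qed.

Lemma word_ge_gt_trans v u w : word_ge u v -> word_gt v w -> word_gt u w.
Proof. by move=> /predU1P[->//|]; apply: word_gt_trans. Qed.

Lemma word_gt_ge_trans v u w : word_gt u v -> word_ge v w -> word_gt u w.
Proof. by move=> uv /predU1P[<-//|]; apply: word_gt_trans. Qed.

Lemma word_ge_trans v u w : word_ge u v -> word_ge v w -> word_ge u w.
Proof.
move=> uv /predU1P[<-//|vw].
by rewrite /word_ge (word_ge_gt_trans uv vw) orbT.
Qed.

Lemma word_ge_refl u : word_ge u u. Proof. exact/predU1l. Qed.
Lemma word_gtW u v : word_gt u v -> word_ge u v. Proof. exact/predU1r. Qed.

Lemma word_geNgt u v : word_ge u v = ~~ word_gt v u.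
Proof.
rewrite /word_ge; have := word_gt_total u v.
have [->|_] /= := eqVneq u v; first by rewrite word_gt_irr.
by case uv: (word_gt u v); [rewrite (word_gt_asym uv)|move=> /= ->].
Qed.

Lemma word_gt_cat2l s u v : word_gt (s ++ u) (s ++ v) = word_gt u v.
Proof. by elim: s => //= x s ->; rewrite ltxx eqxx. Qed.

Lemma word_gt_prefix u t : t != [::] -> word_gt u (u ++ t).
Proof. by case: t => // y t _; rewrite -{1}[u]cats0 word_gt_cat2l. Qed.

(** When [u] is not a prefix of [v], the comparison is decided at a letter that both words have, so
    appending anything keeps it. *)
Lemma word_gt_cat u v s t :
  word_gt u v -> ~~ prefix u v -> word_gt (u ++ s) (v ++ t).
Proof.
elim: u v => [|x u IH] [|y v] //=.
case/orP=> [->//|/andP[/eqP<- uv]].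
by rewrite !eqxx /= => /(IH _ uv)->; rewrite orbT.
Qed.

Lemma prefix_sizeN u v : (size v <= size u)%N -> word_gt u v -> ~~ prefix u v.
Proof.
move=> vu uv; apply/negP => /prefixP[t vE]; move: vu uv; rewrite vE size_cat.
rewrite -{2}[size u]addn0 leq_add2l leqn0 size_eq0 => /eqP->.
by rewrite cats0 word_gt_irr.
Qed.

Lemma word_gt_cat_le u v s t : (size v <= size u)%N ->
  word_gt u v -> word_gt (u ++ s) (v ++ t).
Proof. by move=> vu uv; apply/word_gt_cat/prefix_sizeN. Qed.

(* Unlike [word_gt], the degree-lexicographic order is compatible with
   concatenation for words of different lengths. *)
Definition wlt v w :=
  (size v < size w)%N || (size v == size w) && word_gt w v.
Definition wle v w := (v == w) || wlt v w.

Lemma wlt_irr : irreflexive wlt.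
Proof. by move=> u; rewrite /wlt ltnn word_gt_irr andbF. Qed.

Lemma wlt_trans : transitive wlt.
Proof.
move=> v u w /orP[uv|/andP[/eqP uv vu]] /orP[vw|/andP[/eqP vw wv]].
- by rewrite /wlt (ltn_trans uv vw).
- by rewrite /wlt -vw uv.
- by rewrite /wlt uv vw.
- by rewrite /wlt uv vw eqxx (word_gt_trans wv vu) orbT.
Qed.

Lemma wlt_total u v : [|| u == v, wlt u v | wlt v u].
Proof.
rewrite /wlt; have := word_gt_total u v.
have [->//|_] /= := eqVneq u v.
case: ltngtP => //= _ /orP[] ->; by rewrite ?orbT.
Qed.

Lemma wlt_asym u v : wlt u v -> wlt v u = false.
Proof.
move=> uv; apply/negP => vu.
by have := wlt_trans uv vu; rewrite wlt_irr.
Qed.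

Lemma wle_lt_trans v u w : wle u v -> wlt v w -> wlt u w.
Proof. by move=> /predU1P[->//|]; apply: wlt_trans. Qed.

Lemma wlt_le_trans v u w : wlt u v -> wle v w -> wlt u w.
Proof. by move=> uv /predU1P[<-//|]; apply: wlt_trans. Qed.

Lemma wle_trans v u w : wle u v -> wle v w -> wle u w.
Proof.
move=> uv /predU1P[<-//|vw].
by rewrite /wle (wle_lt_trans uv vw) orbT.
Qed.

Lemma wle_refl u : wle u u. Proof. exact/predU1l. Qed.
Lemma wltW u v : wlt u v -> wle u v. Proof. exact/predU1r. Qed.

Lemma wleNgt u v : wle u v = ~~ wlt v u.
Proof.
rewrite /wle; have := wlt_total u v.
have [->|_] /= := eqVneq u v; first by rewrite wlt_irr.
by case uv: (wlt u v); [rewrite (wlt_asym uv)|move=> /= ->].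
Qed.

Lemma wlt_cat u v s t : wlt u v -> wlt (s ++ u ++ t) (s ++ v ++ t).
Proof.
rewrite /wlt !size_cat !ltn_add2l !ltn_add2r !eqn_add2l !eqn_add2r.
case: ltngtP => //= uv vu.
by rewrite word_gt_cat2l word_gt_cat_le // uv.
Qed.

Lemma wlt_cat2l u v s : wlt u v -> wlt (s ++ u) (s ++ v).
Proof. by move=> /(wlt_cat s [::]); rewrite !cats0. Qed.

Lemma wlt_cat2r u v t : wlt u v -> wlt (u ++ t) (v ++ t).
Proof. exact: wlt_cat [::] t. Qed.

Lemma wle_cat u v s t : wle u v -> wle (s ++ u ++ t) (s ++ v ++ t).
Proof. by move=> /predU1P[->|/(wlt_cat s t)/wltW//]; apply: wle_refl. Qed.

Fixpoint words (F : seq X) n : seq (seq X) :=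
  if n is n'.+1 then [::] :: [seq x :: w | x <- F, w <- words F n'] else [:: [::]].

Lemma mem_words F n w : (w \in words F n) = all (mem F) w && (size w <= n)%N.
Proof.
elim: n w => [|n IH] [|x w] //=; rewrite ?andbF // inE /=.
apply/allpairsP/idP => [[[y v] /= [Fy]]|].
  by rewrite IH => /andP[Fv sv] [-> ->]; rewrite Fy Fv ltnS.
rewrite ltnS => /andP[/andP[Fx Fw] sw]; exists (x, w).
by split=> //=; rewrite IH Fw.
Qed.

(** A word below [w] is at most as long as [w], so over [F] only the finite list [words F (size w)]
    matters. *)
Lemma wlt_ind (F : seq X) (P : seq X -> Prop) :
  (forall w, all (mem F) w ->
     (forall v, all (mem F) v -> wlt v w -> P v) -> P w) ->
  forall w, all (mem F) w -> P w.
Proof.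
move=> IH w Fw; have: w \in words F (size w) by rewrite mem_words Fw leqnn.
move: (size w) => {Fw} n.
move: w; apply: (finite_wf_ind (@wlt_irr) (@wlt_trans)) => u.
rewrite mem_words => /andP[Fu su] IHu; apply: IH => // v Fv vu.
apply: IHu => //; rewrite mem_words Fv /= (leq_trans _ su) //.
by case/orP: vu => [/ltnW//|/andP[/eqP->]].
Qed.

End WordOrder.

(** * Lyndon-Shirshov words and Hall trees *)

HB.instance Definition _ (T : Type) := gen_eqMixin (tree T).

(** One fold for three targets: the free algebra, L, and their product. *)
Fixpoint tree_eval (T M : Type) (br : M -> M -> M) (g : T -> M) (t : tree T) : M :=
  match t with
  | Leaf x => g x
  | Node t1 t2 => br (tree_eval br g t1) (tree_eval br g t2)
  end.

Section HallTrees.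
Variables (d : Order.disp_t) (B : orderType d).
Local Notation X := (gen B).
Implicit Types (u v w s : seq X) (x y z : X) (t h : tree X).

Lemma alpha_neq0 t : alpha t != [::].
Proof. by elim: t => //= t1; case: (alpha t1). Qed.

Lemma alpha_size_gt0 t : (0 < size (alpha t))%N.
Proof. by rewrite lt0n size_eq0 alpha_neq0. Qed.

Lemma cat_eq_splitP u v u' v' : u ++ v = u' ++ v' ->
  (exists s, u = u' ++ s /\ v' = s ++ v) \/ (exists s, u' = u ++ s /\ v = s ++ v').
Proof.
elim: u u' => [|x u IH] [|y u'] /=.
- by left; exists [::].
- by move=> ->; right; exists (y :: u').
- by move=> <-; left; exists (x :: u).
by case=> <- /IH[] [s [-> ->]]; [left|right]; exists s.
Qed.

Definition lyndon w :=
  forall u v, w = u ++ v -> u != [::] -> v != [::] -> word_gt w v.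

Lemma lyndon_cat u v :
  u != [::] -> lyndon u -> lyndon v -> word_gt u v -> lyndon (u ++ v).
Proof.
move=> u0 Lu Lv uv.
have uvv: word_gt (u ++ v) v.
  (* If [v = u ++ w], cancelling [u] leaves [v] against its own proper suffix [w]. *)
  have [/prefixP[w vE]|] := boolP (prefix u v); last first.
    by move=> uv'; rewrite -[X in word_gt _ X]cats0 word_gt_cat.
  rewrite vE word_gt_cat2l -vE; apply: (Lv u w) => //.
  by apply: contraTneq uv => w0; rewrite vE w0 cats0 word_gt_irr.
move=> p s uvE p0 s0; rewrite uvE -uvE; case/cat_eq_splitP: uvE => [] [r [E1 E2]].
  have [r0|r0] := eqVneq r [::]; first by rewrite E2 r0.
  rewrite E2; apply: word_gt_cat_le; first by rewrite E1 size_cat leq_addl.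
  exact: Lu E1 _ _.
have [r0|r0] := eqVneq r [::].
  by move: E2; rewrite r0 => /= <-.
by apply: word_gt_trans uvv _; apply: Lv E2 _ _.
Qed.

Lemma hall_lyndon h : hall h -> lyndon (alpha h).
Proof.
elim: h => [x _ [|? [|? ?]] [|? ?]//|h1 IH1 h2 IH2 /= /and4P[/IH1 L1 /IH2 L2 gt12 _]].
by apply: lyndon_cat => //; apply: alpha_neq0.
Qed.

Lemma hall_Node_gt h1 h2 : hall (Node h1 h2) ->
  word_gt (alpha (Node h1 h2)) (alpha h2).
Proof. by move=> /hall_lyndon/(_ (alpha h1) (alpha h2) erefl); apply; apply: alpha_neq0. Qed.

Lemma hall_Node_swap h1 h2 : hall (Node h1 h2) ->
  word_gt (alpha h1 ++ alpha h2) (alpha h2 ++ alpha h1).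
Proof.
move=> /hall_Node_gt /= gt; rewrite -[alpha h1 ++ _]cats0.
by apply: word_gt_cat_le => //; rewrite size_cat leq_addl.
Qed.

(* So no proper suffix of [alpha (Node h1 h2)] that is longer than [alpha h2] is
   Lyndon, and [alpha] determines the tree. *)
Lemma hall_suffix_le h1 h2 u v : hall (Node h1 h2) ->
  alpha h1 = u ++ v -> u != [::] -> v != [::] -> word_ge (alpha h2) v.
Proof.
elim: h1 h2 u v => [x|h1 IH1 h1' IH1'] h2 u v /=.
  by move=> _; case: u => [|? [|? ?]] //; case: v.
move=> /and4P[/and4P[H1 H1' gt1 c1] H2 gt c2] /esym/cat_eq_splitP[] [s [E1 E2]] u0 v0.
  have [s0|s0] := eqVneq s [::]; first by move: E2 c2; rewrite s0 /= => ->.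
  apply: word_ge_trans c2 _; rewrite /word_ge; apply/orP; right.
  by apply: (hall_lyndon H1') E2 s0 v0.
have [s0|s0] := eqVneq s [::]; first by move: E2 c2; rewrite s0 /= => ->.
have H : hall (Node h1 h1') by rewrite /= H1 H1' gt1.
apply: word_ge_trans c2 _; rewrite E2; apply: word_ge_trans (IH1 _ _ _ H E1 u0 s0) _.
by apply/word_gtW/word_gt_prefix/alpha_neq0.
Qed.

Lemma hall_alpha_inj h h' : hall h -> hall h' -> alpha h = alpha h' -> h = h'.
Proof.
(* A nonempty [s] would give the cycle [s] <= [alpha g2] < [alpha g2'] = [s ++ alpha g2] < [s], the
   last step because a proper prefix is larger. *)
have long g1 g2 g1' g2' s : hall (Node g1 g2) -> hall (Node g1' g2') ->
    alpha g1 = alpha g1' ++ s -> alpha g2' = s ++ alpha g2 -> s = [::].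
  move=> Hg Hg' E1 E2; apply/eqP/contraT => s0.
  have ge := hall_suffix_le Hg E1 (alpha_neq0 _) s0.
  have /and4P[_ Hg2' _ _] := Hg'.
  have gt := hall_lyndon Hg2' E2 s0 (alpha_neq0 _).
  have := word_gt_ge_trans gt ge; rewrite E2.
  by rewrite word_gt_asym // word_gt_prefix // alpha_neq0.
elim: h h' => [x|h1 IH1 h2 IH2] [y|h1' h2'] /=.
- by move=> _ _ [->].
- move=> _ _; have := alpha_size_gt0 h1'; have := alpha_size_gt0 h2'.
  by case: (alpha h1') (alpha h2') => [|? [|? ?]] [|? ?].
- move=> _ _; have := alpha_size_gt0 h1; have := alpha_size_gt0 h2.
  by case: (alpha h1) (alpha h2) => [|? [|? ?]] [|? ?].
move=> H H' E; have [E1 E2] : alpha h1 = alpha h1' /\ alpha h2 = alpha h2'.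
  case/cat_eq_splitP: E => [] [s [E1 E2]].
    by rewrite E1 E2 (long _ _ _ _ s H H' E1 E2) cats0.
  by rewrite E1 E2 (long _ _ _ _ s H' H E1 E2) cats0.
have /and4P[h1H h2H _ _] := H; have /and4P[h1H' h2H' _ _] := H'.
by congr Node; [apply: IH1|apply: IH2].
Qed.

Lemma word_gt_head x u y v : word_gt (x :: u) (y :: v) -> (y <= x)%O.
Proof. by case/orP=> [/ltW//|/andP[/eqP->]]. Qed.

(** The condition [alpha h1 > alpha h2] compares first letters, so the head of the left branch
    dominates the head of the right one. *)
Lemma hall_head_max h x u : hall h -> alpha h = x :: u ->
  all (fun y => (y <= x)%O) (alpha h).
Proof.
elim: h x u => [z|h1 IH1 h2 IH2] x u /=; first by move=> _ [-> _]; rewrite lexx.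
move=> /and4P[H1 H2 gt _]; have := alpha_neq0 h2.
case E2: (alpha h2) (alpha_neq0 h1) => [//|z v].
case E1: (alpha h1) => [//|y w] _ _ [yx _]; rewrite all_cat.
move: gt (IH1 _ _ H1 E1) (IH2 _ _ H2 E2); rewrite E1 E2 yx => /word_gt_head zx.
by move=> ->; rewrite andTb; apply: sub_all => a /= /le_trans; apply.
Qed.

End HallTrees.

(** * Leading words in a free algebra *)

Definition comm (R : nzRingType) (p q : R) := p * q - q * p.

(** The interface of the free algebra through which the argument runs: a multiplicative basis of
    words with coefficient functionals. As [mon_lspan] expands an element over its own support,
    conditions on coefficients become membership in a span. *)
Record freeAlgebra (K : fieldType) (T : eqType) := FreeAlgebra {
  free_algebra_sort :> algType K;
  mon : seq T -> free_algebra_sort;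
  wcoef : seq T -> free_algebra_sort -> K;
  mon_nil : mon [::] = 1;
  monM : forall u v, mon u * mon v = mon (u ++ v);
  wcoefP : forall w c p q, wcoef w (c *: p + q) = c * wcoef w p + wcoef w q;
  wcoef_mon : forall w v, wcoef w (mon v) = (v == w)%:R;
  mon_lspan : forall p, lspan (fun q => exists2 w, wcoef w p != 0 & q = mon w) p
}.

Arguments mon {K T} _ _.

Section FreeAlgebra.
Variables (K : fieldType) (d : Order.disp_t) (B : orderType d).
Local Notation X := (gen B).
Variable A : freeAlgebra K X.
Local Notation mon := (mon A).
Implicit Types (u v w s : seq X) (x y z : X) (t h : tree X) (p q : A) (F : seq X).

Lemma wcoef0 w : wcoef w (0 : A) = 0.
Proof.
by have := wcoefP w (-1) (0 : A) 0; rewrite scaler0 addr0 mulN1r addNr.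
Qed.
Lemma wcoefD w p q : wcoef w (p + q) = wcoef w p + wcoef w q.
Proof. by rewrite -[p]scale1r wcoefP mul1r scale1r. Qed.
Lemma wcoefZ w c p : wcoef w (c *: p) = c * wcoef w p.
Proof. by rewrite -[c *: p]addr0 wcoefP wcoef0 addr0. Qed.
Lemma wcoefB w p q : wcoef w (p - q) = wcoef w p - wcoef w q.
Proof. by rewrite wcoefD -scaleN1r wcoefZ mulN1r. Qed.

Lemma wcoef_sum w (I : Type) (r : seq I) (G : I -> A) :
  wcoef w (\sum_(i <- r) G i) = \sum_(i <- r) wcoef w (G i).
Proof. by apply: big_morph => [p q|]; rewrite ?wcoefD ?wcoef0. Qed.

Definition supp_in (P : seq X -> Prop) p := forall w, wcoef w p != 0 -> P w.

Lemma supp_in_sub (P Q : seq X -> Prop) p :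
  (forall w, P w -> Q w) -> supp_in P p -> supp_in Q p.
Proof. by move=> PQ Pp w /Pp/PQ. Qed.

Lemma supp_in0 P : supp_in P 0.
Proof. by move=> w; rewrite wcoef0 eqxx. Qed.

Lemma supp_inD P p q : supp_in P p -> supp_in P q -> supp_in P (p + q).
Proof.
move=> Pp Pq w; rewrite wcoefD; have [->|/Pp//] := eqVneq (wcoef w p) 0.
by rewrite add0r => /Pq.
Qed.

Lemma supp_inZ P c p : supp_in P p -> supp_in P (c *: p).
Proof. by move=> Pp w; rewrite wcoefZ mulf_eq0 negb_or => /andP[_ /Pp]. Qed.

Lemma supp_inN P p : supp_in P p -> supp_in P (- p).
Proof. by rewrite -scaleN1r; apply: supp_inZ. Qed.

Lemma supp_inB P p q : supp_in P p -> supp_in P q -> supp_in P (p - q).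
Proof. by move=> Pp Pq; apply: supp_inD => //; apply: supp_inN. Qed.

Lemma supp_in_mon (P : seq X -> Prop) w : P w -> supp_in P (mon w).
Proof. by move=> Pw v; rewrite wcoef_mon; have [->//|_] := eqVneq v w; rewrite eqxx. Qed.

Lemma supp_in_sum P (I : eqType) (r : seq I) (G : I -> A) :
  {in r, forall i, supp_in P (G i)} -> supp_in P (\sum_(i <- r) G i).
Proof.
move=> PG; rewrite big_seq; elim/big_ind: _ => [|p q|i /PG//].
  exact: supp_in0.
exact: supp_inD.
Qed.

Lemma supp_in_lspan P p : supp_in P p <-> lspan (fun q => exists2 w, P w & q = mon w) p.
Proof.
split=> [Pp|].
  apply: lspan_sub (mon_lspan p) => _ [w /Pp Pw ->].
  by apply: lspan_gen; exists w.
elim=> [|c g q [w Pw ->] _ IH]; first exact: supp_in0.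
by apply: supp_inD IH; apply: supp_inZ; apply: supp_in_mon.
Qed.

Lemma supp_inM (P Q R : seq X -> Prop) p q :
    (forall u v, P u -> Q v -> R (u ++ v)) ->
  supp_in P p -> supp_in Q q -> supp_in R (p * q).
Proof.
move=> PQR /supp_in_lspan Pp /supp_in_lspan Qq; apply/supp_in_lspan.
apply: (lspan_map (f := fun r => r * q)) Pp; first by rewrite mul0r.
  by move=> c r s; rewrite mulrDl scalerAl.
move=> _ [u Pu ->]; apply: (lspan_map (f := fun r => mon u * r)) Qq.
- by rewrite mulr0.
- by move=> c r s; rewrite mulrDr scalerAr.
by move=> _ [v Qv ->]; apply: lspan_gen; exists (u ++ v); [apply: PQR|apply: monM].
Qed.

Definition below F w v := all (mem F) v && wlt v w.

(** Monic with leading word [w]; the tail is also kept over [F], so that later inductions never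
    leave the finite alphabet. *)
Definition lead F w p := supp_in (below F w) (p - mon w).

Lemma wlead_coef F w p : lead F w p -> wcoef w p = 1.
Proof.
move=> Lp; apply/eqP; rewrite -subr_eq0; apply/negPn/negP => pw.
have := Lp w; rewrite wcoefB wcoef_mon eqxx => /(_ pw).
by rewrite /below wlt_irr andbF.
Qed.

Lemma lead_supp F w p : lead F w p -> supp_in (fun v => wle v w) p.
Proof.
move=> Lp; rewrite -[p](subrK (mon w)); apply: supp_inD.
  by apply: supp_in_sub Lp => v /andP[_ /wltW].
by apply: supp_in_mon; apply: wle_refl.
Qed.

Lemma lead_suppF F w p :
  all (mem F) w -> lead F w p -> supp_in (fun v => all (mem F) v) p.
Proof.
move=> Fw Lp; rewrite -[p](subrK (mon w)); apply: supp_inD.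
  by apply: supp_in_sub Lp => v /andP[].
exact: supp_in_mon.
Qed.

Lemma lead_mon F w : lead F w (mon w).
Proof. by rewrite /lead subrr; apply: supp_in0. Qed.

Lemma leadM F u v p q : all (mem F) u -> all (mem F) v ->
  lead F u p -> lead F v q -> lead F (u ++ v) (p * q).
Proof.
move=> Fu Fv Lp Lq; rewrite /lead.
have -> : p * q - mon (u ++ v) =
    (p - mon u) * q + mon u * (q - mon v).
  by rewrite mulrBl mulrBr monM addrA subrK.
apply: supp_inD.
  apply: (supp_inM _ Lp (Q := fun w => all (mem F) w && wle w v)) => [a b|].
    rewrite /below all_cat => /andP[-> av] /andP[-> bv] /=.
    apply: wlt_le_trans (wlt_cat2r _ av) _; have := wle_cat u [::] bv.
    by rewrite !cats0.
  move=> w qw; rewrite (lead_supp Lq) // andbT; exact: lead_suppF Fv Lq _ qw.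
apply: (supp_inM _ (supp_in_mon (P := eq u) erefl) Lq) => _ b <-.
by rewrite /below all_cat Fu => /andP[-> /wlt_cat2l->].
Qed.

Lemma leadB F w v p q : all (mem F) v -> wlt v w ->
  lead F w p -> lead F v q -> lead F w (p - q).
Proof.
move=> Fv vw Lp Lq; rewrite /lead (addrAC p); apply: supp_inB Lp _.
move=> u qu; rewrite /below (lead_suppF Fv Lq) //=.
by apply: wle_lt_trans vw; apply: lead_supp Lq _ _.
Qed.

Lemma lead_comm F u v p q : all (mem F) u -> all (mem F) v ->
    word_gt (u ++ v) (v ++ u) ->
  lead F u p -> lead F v q -> lead F (u ++ v) (comm p q).
Proof.
move=> Fu Fv uv Lp Lq; apply: (leadB (v := v ++ u)).
- by rewrite all_cat Fu Fv.
- by rewrite /wlt !size_cat addnC eqxx uv orbT.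
- exact: leadM Lp Lq.
- exact: leadM Lq Lp.
Qed.

Definition tree_comm t : A := tree_eval (@comm A) (fun x => mon [:: x]) t.

Lemma tree_comm_lead F h : hall h -> all (mem F) (alpha h) ->
  lead F (alpha h) (tree_comm h).
Proof.
elim: h => [x _ _|h1 IH1 h2 IH2 H].
  exact: lead_mon.
rewrite [alpha _]/= all_cat => /andP[F1 F2].
have /and4P[H1 H2 _ _] := H.
apply: lead_comm => //; [exact: hall_Node_swap|exact: IH1|exact: IH2].
Qed.

Lemma exists_max_alpha (r : seq (tree X)) : r != [::] ->
  exists2 h, h \in r & {in r, forall g, wle (alpha g) (alpha h)}.
Proof.
elim: r => // h r IH _; have [->|/IH[g gr gmax]] := eqVneq r [::].
  by exists h => [|g]; rewrite inE // => /eqP->; apply: wle_refl.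
have [gh|] := boolP (wle (alpha g) (alpha h)).
  exists h => [|k]; rewrite !inE ?eqxx // => /predU1P[->|/gmax kg].
    exact: wle_refl.
  exact: wle_trans gh.
rewrite wleNgt negbK => hg; exists g => [|k]; rewrite !inE ?gr ?orbT //.
by move=> /predU1P[->|/gmax//]; apply: wltW.
Qed.

(** By [hall_alpha_inj] different Hall trees have different leading words, so the largest one with a
    nonzero coefficient cannot cancel. *)
Lemma hall_sum_max (r : seq (tree X)) (c : tree X -> K) h1 :
    uniq r -> {in r, forall h, hall h} -> h1 \in r -> c h1 != 0 ->
  let f := \sum_(h <- r) c h *: tree_comm h in
  exists h0, [/\ h0 \in r, c h0 != 0, wcoef (alpha h0) f = c h0,
    supp_in (fun v => wle v (alpha h0)) f &
    {in r, forall h, c h != 0 -> wle (alpha h) (alpha h0)}].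
Proof.
move=> ur Hr h1r ch1 f.
have [h0] : exists2 h, h \in [seq h <- r | c h != 0] &
    {in [seq h <- r | c h != 0], forall g, wle (alpha g) (alpha h)}.
  apply: exists_max_alpha; rewrite -has_filter.
  by apply/hasP; exists h1.
rewrite mem_filter => /andP[ch0 h0r] hmax.
have lam h : h \in r -> lead (alpha h) (alpha h) (tree_comm h).
  by move=> hr; apply: tree_comm_lead (Hr _ hr) _; apply/allP.
have le h : h \in r -> c h != 0 -> wle (alpha h) (alpha h0).
  by move=> hr ch; apply: hmax; rewrite mem_filter ch.
exists h0; split => //.
  transitivity (\sum_(h <- r) c h * wcoef (alpha h0) (tree_comm h)).
    by rewrite /f wcoef_sum; apply: eq_bigr => h _; rewrite wcoefZ.
  rewrite (bigD1_seq _ h0r ur) /= (wlead_coef (lam _ h0r)) mulr1 -[RHS]addr0.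
  congr (_ + _); rewrite big_seq_cond big1 // => h /andP[hr hh0].
  have [->|ch] := eqVneq (c h) 0; first by rewrite mul0r.
  apply/eqP; rewrite mulf_eq0 (negPf ch) /=; apply/negPn/negP => /(lead_supp (lam _ hr)).
  move=> le0; have := le _ hr ch; rewrite wleNgt => /negP; apply.
  case/predU1P: le0 => // E.
  by rewrite (hall_alpha_inj (Hr _ h0r) (Hr _ hr) E) eqxx in hh0.
apply: supp_in_sum => h hr; have [->|ch] := eqVneq (c h) 0.
  by rewrite scale0r; apply: supp_in0.
apply: supp_inZ; apply: supp_in_sub (lead_supp (lam _ hr)) => v vh.
by apply: wle_trans vh _; apply: le.
Qed.

End FreeAlgebra.

(** * Hall trees span *)

Section HallSpanning.
Variables (K : fieldType) (d : Order.disp_t) (B : orderType d) (M : lmodType K).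
Local Notation X := (gen B).
Variables (br : M -> M -> M) (g : X -> M).
Hypothesis brDl : forall x y z, br (x + y) z = br x z + br y z.
Hypothesis brDr : forall x y z, br x (y + z) = br x y + br x z.
Hypothesis brZl : forall (c : K) x y, br (c *: x) y = c *: br x y.
Hypothesis brZr : forall (c : K) x y, br x (c *: y) = c *: br x y.
Hypothesis br_alt : forall x, br x x = 0.
Hypothesis br_jacobi :
  forall x y z, br x (br y z) + br y (br z x) + br z (br x y) = 0.

Local Notation tree_eval := (tree_eval br g).

Let br0l y : br 0 y = 0.
Proof. by have := brZl 0 0 y; rewrite !scale0r. Qed.

Let br0r x : br x 0 = 0.
Proof. by have := brZr 0 x 0; rewrite !scale0r. Qed.

Let brC x y : br x y = - br y x.
Proof.
apply/eqP; rewrite -subr_eq0 opprK; apply/eqP.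
by have := br_alt (x + y); rewrite brDl !brDr !br_alt add0r addr0.
Qed.

Let brNl x y : br (- x) y = - br x y.
Proof. by rewrite -scaleN1r brZl scaleN1r. Qed.

Let brA x y z : br (br x y) z = br (br x z) y + br x (br y z).
Proof.
have := br_jacobi x y z => /eqP; rewrite addr_eq0 => /eqP E.
by rewrite [LHS]brC -E addrC; congr (_ + _); rewrite brC [br x z]brC brNl.
Qed.

Let lspan_br (G1 G2 H : M -> Prop) :
    (forall m1 m2, G1 m1 -> G2 m2 -> lspan H (br m1 m2)) ->
  forall x y, lspan G1 x -> lspan G2 y -> lspan H (br x y).
Proof.
move=> GH x y Gx Gy; apply: (@lspan_map _ _ _ _ _ (br^~ y)) Gx => [|c a b|m Gm].
- exact: br0l.
- by rewrite brDl brZl.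
apply: (@lspan_map _ _ _ _ _ (br m)) Gy => [|c a b|n Gn].
- exact: br0r.
- by rewrite brDr brZr.
exact: GH.
Qed.

Variable F : seq X.

(** A right branch at least [w] forces [alpha h > w], since a Lyndon-Shirshov word exceeds its
    suffixes. Leaves are excluded because brackets have size at least two. *)
Let bounded n w (h : tree X) := [&& hall h, all (mem F) (alpha h),
  size (alpha h) == n & if h is Node _ h2 then word_ge (alpha h2) w else false].

Let bounded_span n w := lspan (fun m => exists2 h, bounded n w h & m = tree_eval h).

Let bounded_gt n w h : bounded n w h -> word_gt (alpha h) w.
Proof.
case: h => [x|h1 h2] /and4P[] // H _ _ /word_gt_ge_trans; apply.
exact: hall_Node_gt.
Qed.

(* Induction on the total size and then, downwards, on the smaller of the two
   words; the bound on the right branches keeps that induction going. *)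
Lemma hall_bracket n (x y : tree X) : hall x -> hall y ->
    all (mem F) (alpha x) -> all (mem F) (alpha y) ->
    (size (alpha x) + size (alpha y))%N = n -> word_gt (alpha x) (alpha y) ->
  bounded_span n (alpha y) (br (tree_eval x) (tree_eval y)).
Proof.
have [m] := ubnP n; elim: m n x y => // m IHm n x y nm Hx Hy Fx Fy nE xy.
have: alpha y \in words F n by rewrite mem_words Fy -nE leq_addl.
move wE: (alpha y) => w wn; move: w wn x y wE Hx Hy Fx Fy nE xy.
apply: (@finite_wf_ind _ (@word_gt d B)).
- exact: word_gt_irr.
- by move=> u v w; apply: word_gt_trans.
move=> w wn IHw x y wE Hx Hy Fx Fy nE xy.
have prod t1 t2 : hall t1 -> hall t2 -> all (mem F) (alpha t1) ->
    all (mem F) (alpha t2) -> (size (alpha t1) + size (alpha t2))%N = n ->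
    word_gt (alpha t1) w -> word_gt (alpha t2) w ->
    bounded_span n w (br (tree_eval t1) (tree_eval t2)).
  have wlog t t' : hall t -> hall t' -> all (mem F) (alpha t) ->
    all (mem F) (alpha t') -> (size (alpha t) + size (alpha t'))%N = n ->
    word_gt (alpha t') w -> word_gt (alpha t) (alpha t') ->
    bounded_span n w (br (tree_eval t) (tree_eval t')).
    move=> H1 H2 F1 F2 sE gt2 gt12.
    apply: (lspan_sub _ (IHw (alpha t') _ gt2 t t' erefl H1 H2 F1 F2 sE gt12)).
      move=> _ [h bh ->]; apply: lspan_gen; exists h => //; move: bh.
      rewrite /bounded => /and4P[-> -> ->]; case: h => //= _ h2 ge.
      by apply: word_ge_trans ge _; apply: word_gtW.
    by rewrite mem_words F2 -sE leq_addl.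
  move=> H1 H2 F1 F2 sE gt1 gt2; case/or3P: (word_gt_total (alpha t1) (alpha t2)).
  - by move/eqP/(hall_alpha_inj H1 H2)->; rewrite br_alt; apply: lspan0.
  - exact: wlog.
  - by move=> gt12; rewrite brC; apply/lspanN/wlog; rewrite // addnC.
have [Hxy|] := boolP (hall (Node x y)).
  apply: lspan_gen; exists (Node x y) => //.
  by rewrite /bounded Hxy /= all_cat Fx Fy size_cat nE eqxx wE word_ge_refl.
rewrite /= Hx Hy xy wE /=; case: x Hx Fx nE xy => [//|x1 x2] Hx.
rewrite [alpha _]/= all_cat size_cat => /andP[F1 F2] nE xy.
rewrite word_geNgt negbK => gt2.
have /and4P[H1 H2 gt12 _] := Hx.
have gt1 := word_gt_trans gt12 gt2.
have ltn1 : (size (alpha x1) + size (alpha y) < m)%N.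
  by rewrite -ltnS (leq_trans _ nm) // ltnS -nE -addnA ltn_add2l -[ltnLHS]add0n
    ltn_add2r alpha_size_gt0.
have ltn2 : (size (alpha x2) + size (alpha y) < m)%N.
  by rewrite -ltnS (leq_trans _ nm) // ltnS -nE -addnA -[ltnLHS]add0n
    ltn_add2r alpha_size_gt0.
(* Here [alpha x2 > alpha y], and [[x1,x2],y] = [[x1,y],x2] + [x1,[x2,y]]. The inner brackets are
   smaller, and their expansions consist of trees with words above [alpha y]; in both outer brackets
   both factors then exceed [alpha y], which is what [prod] requires. *)
rewrite [tree_eval _]/= brA; apply: lspanD.
  apply: (lspan_br _ (IHm _ x1 y ltn1 H1 Hy F1 Fy erefl _) (@lspan_gen _ _ (eq (tree_eval x2)) _ erefl));
    last by rewrite wE.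
  move=> _ _ [h bh ->] <-; have hw := bounded_gt bh.
  have /and4P[Hh Fh /eqP sh _] := bh; apply: prod => //; last by rewrite -wE.
  by rewrite sh -nE addnAC.
apply: (lspan_br _ (@lspan_gen _ _ (eq (tree_eval x1)) _ erefl) (IHm _ x2 y ltn2 H2 Hy F2 Fy erefl _));
  last by rewrite wE.
move=> _ _ <- [h bh ->]; have hw := bounded_gt bh.
have /and4P[Hh Fh /eqP sh _] := bh; apply: prod => //; last by rewrite -wE.
by rewrite sh -nE addnA.
Qed.

(** The bracket is arbitrary subject to the Lie axioms, because the result is applied both to
    [lie_br] on L and to [pair_br] on L x A. *)
Lemma hall_spanning (t : tree X) : all (mem F) (alpha t) ->
  lspan (fun m => exists2 h, hall h && all (mem F) (alpha h) & m = tree_eval h)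
    (tree_eval t).
Proof.
elim: t => [x /=|t1 IH1 t2 IH2]; first by move=> Fx; apply: lspan_gen; exists (Leaf x).
rewrite /= all_cat => /andP[/IH1 S1 /IH2 S2].
apply: lspan_br S1 S2 => _ _ [h /andP[H Fh] ->] [k /andP[Hk Fk] ->].
have wlog t t' : hall t -> hall t' -> all (mem F) (alpha t) ->
    all (mem F) (alpha t') -> word_gt (alpha t) (alpha t') ->
    lspan (fun m => exists2 h, hall h && all (mem F) (alpha h) & m = tree_eval h)
      (br (tree_eval t) (tree_eval t')).
  move=> Ht Ht' Ft Ft' gt; apply: lspan_sub (hall_bracket Ht Ht' Ft Ft' erefl gt).
  move=> _ [l /and4P[Hl Fl _ _] ->]; apply: lspan_gen; exists l => //.
  by rewrite Hl.
case/or3P: (word_gt_total (alpha h) (alpha k)) => [/eqP|gt|gt].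
- by move/(hall_alpha_inj H Hk)->; rewrite br_alt; apply: lspan0.
- exact: wlog.
- by rewrite brC; apply/lspanN/wlog.
Qed.

End HallSpanning.

(** * Locality relators and their compositions *)

Lemma jacobi_cancel (V : zmodType) (x1 x2 x3 x4 x5 x6 : V) :
  x1 - x2 - (x3 - x4) + (x5 - x4 - (x1 - x6)) - (x6 - x3 - (x2 - x5)) = 0.
Proof.
rewrite !opprB !addrA.
rewrite [LHS](ACl ((1*8)*(2*9)*(3*6)*(4*11)*(5*10)*(7*12)))%AC /=.
by rewrite !(subrr, addNr, addr0).
Qed.

Section Relators.
Variables (K : fieldType) (d : Order.disp_t) (B : orderType d) (N : nat).
Hypothesis charK : [pchar K] =i pred0.
Hypothesis N_gt0 : (0 < N)%N.
Local Notation X := (gen B).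
Variables (A : algType K) (mon : seq X -> A).
Implicit Types (u v w : seq X) (x y z : X) (p q : A) (F : seq X) (a b c : B).

Definition sgnbin s : K := (-1) ^+ s * 'C(N, s)%:R.

Definition loc_rel b a (n m : int) : A :=
  \sum_(0 <= s < N.+1) sgnbin s *:
     comm (mon [:: mkgen b (n - s%:Z)]) (mon [:: mkgen a (m + s%:Z)]).

(** The monic form of the relator of a bad pair. For equal generators with index gap [N] (then [N]
    is odd), the terms s = 0 and s = N are the same commutator, so the leading coefficient is 2. *)
Definition rho x y : A :=
  (if (x.1 - y.1 == N%:Z) && (x.2 == y.2) then 2^-1 else 1) *:
    loc_rel x.2 y.2 x.1 y.1.

Lemma natK_neq0 n : (0 < n)%N -> n%:R != 0 :> K.
Proof. by move=> n0; rewrite ((pcharf0P _).1 charK) -lt0n. Qed.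

Lemma comm_antisym p q : comm p q = - comm q p.
Proof. by rewrite /comm opprB. Qed.

Lemma commZl (c : K) p q : comm (c *: p) q = c *: comm p q.
Proof. by rewrite /comm -scalerAl -scalerAr scalerBr. Qed.

Lemma commDl p q r : comm (p + q) r = comm p r + comm q r.
Proof. by rewrite /comm mulrDl mulrDr opprD addrACA. Qed.

Lemma commZr (c : K) p q : comm p (c *: q) = c *: comm p q.
Proof. by rewrite !(comm_antisym p) commZl scalerN. Qed.

Lemma commDr p q r : comm p (q + r) = comm p q + comm p r.
Proof. by rewrite !(comm_antisym p) commDl opprD. Qed.

Lemma comm_suml (I : Type) (r : seq I) (G : I -> A) q :
  comm (\sum_(i <- r) G i) q = \sum_(i <- r) comm (G i) q.
Proof.
by rewrite /comm mulr_suml mulr_sumr -sumrB.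
Qed.

Lemma comm_jacobi p q r :
  comm (comm p q) r + comm (comm q r) p - comm (comm p r) q = 0.
Proof.
by rewrite /comm !mulrBl !mulrBr !mulrA; apply: jacobi_cancel.
Qed.

Lemma comm_jacobi_cyclic p q r :
  comm p (comm q r) + comm q (comm r p) + comm r (comm p q) = 0.
Proof.
have := comm_jacobi p q r => /eqP; rewrite subr_eq0 => /eqP E.
rewrite (comm_antisym r (comm p q)) (comm_antisym p (comm q r)).
rewrite (comm_antisym q (comm r p)) (comm_antisym r p) -[- comm p r]scaleN1r commZl scaleN1r.
by rewrite opprK -E addrCA addNr addr0 subrr.
Qed.

Lemma sgnbin0 : sgnbin 0 = 1.
Proof. by rewrite /sgnbin expr0 bin0 mulr1. Qed.

Lemma sgnbinN : sgnbin N = (-1) ^+ N.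
Proof. by rewrite /sgnbin binn mulr1. Qed.

(** Replace s by N - s and swap every commutator. This mirror image of a relator recurs in all the
    estimates below. *)
Lemma loc_relC b a n m :
  loc_rel b a n m = (-1) ^+ N.+1 *: loc_rel a b (m + N%:Z) (n - N%:Z).
Proof.
rewrite /loc_rel big_nat_rev /= scaler_sumr; apply: eq_big_nat => s /andP[_ sN].
rewrite add0n subSS scalerA comm_antisym -scaleN1r scalerA; congr (_ *: comm (mon [:: mkgen a _]) (mon [:: mkgen b _])).
- rewrite /sgnbin bin_sub // -signr_odd oddB // signr_addb !signr_odd.
  by rewrite mulrN1 exprS mulN1r mulNr mulrA.
- lia.
- lia.
Qed.

(** The relator is its own mirror image with sign -1, so twice the relator is zero. *)
Lemma loc_rel_even b n m : n - m = N%:Z -> ~~ odd N -> loc_rel b b n m = 0.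
Proof.
move=> nm evN; have := loc_relC b b n m.
have -> : m + N%:Z = n by lia.
have -> : n - N%:Z = m by lia.
rewrite -signr_odd /= evN expr1 scaleN1r => /eqP; rewrite -addr_eq0 => /eqP E.
have : 2%:R *: loc_rel b b n m = 0 by rewrite scaler_nat mulr2n.
by move/eqP; rewrite scaler_eq0 (negPf (natK_neq0 _)) //= => /eqP.
Qed.

Lemma loc_rel_bad b a n m : bad_pair N (mkgen b n) (mkgen a m) ->
  exists2 k, (0 < k)%N & loc_rel b a n m = k%:R *: rho (mkgen b n) (mkgen a m).
Proof.
move=> bad; rewrite /rho /=; case: ifP => _.
  by exists 2%N => //; rewrite scalerA divff ?scale1r // natK_neq0.
by exists 1%N => //; rewrite !scale1r.
Qed.

(** If n - m < N, the mirrored pair has gap 2N - (n - m) > N and is bad. At gap exactly [N], neither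
    pair is bad only for equal generators and even [N], where the relator vanishes. The map [f]
    stands for multiplication by a letter or for the identity. *)
Lemma loc_rel_rho (G : A -> Prop) (f : A -> A) b a n m :
    (forall (k : K) p, f (k *: p) = k *: f p) ->
    (bad_pair N (mkgen b n) (mkgen a m) ->
       lspan G (f (rho (mkgen b n) (mkgen a m)))) ->
    (bad_pair N (mkgen a (m + N%:Z)) (mkgen b (n - N%:Z)) ->
       lspan G (f (rho (mkgen a (m + N%:Z)) (mkgen b (n - N%:Z))))) ->
  lspan G (f (loc_rel b a n m)).
Proof.
move=> fZ H1 H2.
have [bad1|nbad1] := boolP (bad_pair N (mkgen b n) (mkgen a m)).
  by have [k _ ->] := loc_rel_bad bad1; rewrite fZ; apply/lspanZ/H1.
have [bad2|nbad2] := boolP (bad_pair N (mkgen a (m + N%:Z)) (mkgen b (n - N%:Z))).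
  rewrite loc_relC fZ; apply: lspanZ.
  by have [k _ ->] := loc_rel_bad bad2; rewrite fZ; apply/lspanZ/H2.
suff -> : loc_rel b a n m = 0 by rewrite -(scale0r 0) fZ scale0r; apply: lspan0.
move: nbad1 nbad2; rewrite /bad_pair /=.
have [ab|ab|ab] := ltgtP a b; rewrite ?andbT ?andbF ?orbF //=; try lia.
by rewrite ab => h1 h2; apply: loc_rel_even; lia.
Qed.

End Relators.

(* A letter is given by its index [k] and by the rank [r] of its generator among
   the at most three generators of the top word [(p, rc) (n, rb) (m, ra)]. *)
Section LexArithmetic.
Variables (N : nat) (p n m : int) (rc rb ra : nat).

Definition lex3 (strict : bool) (k1 : int) (r1 : nat) (k2 : int) (r2 : nat) (k3 : int) (r3 : nat) :=
  k1 < p \/ k1 = p /\ ((r1 < rc)%N \/ r1 = rc /\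
   (k2 < n \/ k2 = n /\ ((r2 < rb)%N \/ r2 = rb /\
   (k3 < m \/ k3 = m /\ (r3 < ra + ~~ strict)%N)))).

Lemma lex3_le k1 r1 k2 r2 k3 r3 : lex3 false k1 r1 k2 r2 k3 r3 ->
  lex3 true k1 r1 k2 r2 k3 r3 \/
    [/\ k1 = p, k2 = n, k3 = m, r1 = rc & r2 = rb /\ r3 = ra].
Proof.
rewrite /lex3 addn0 addn1 ltnS.
case=> [?|[-> [?|[-> [?|[-> [?|[-> [?|[-> le]]]]]]]]]]; try by left; auto 10.
by move: le; rewrite leq_eqVlt => /predU1P[->|?]; [right|left; auto 12].
Qed.

(** The clauses with shifts by [N], here and in the next two definitions, concern the mirrored
    relator of [loc_relC], which [loc_rel_rho] may substitute. *)
Definition rel_range (k1 k2 k3 : int) : Prop :=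
  [/\ m <= k1 <= p, m <= k2 <= p, m <= k3 <= p, m <= k2 + N%:Z <= p & m <= k1 - N%:Z <= p].

Definition rel_left_le k1 r1 k2 r2 k3 r3 :=
  lex3 false k1 r1 k2 r2 k3 r3 /\ lex3 false k1 r1 (k3 + N%:Z) r3 (k2 - N%:Z) r2.

Definition rel_right_lt k1 r1 k2 r2 k3 r3 :=
  lex3 true k1 r1 k2 r2 k3 r3 /\ lex3 true (k2 + N%:Z) r2 (k1 - N%:Z) r1 k3 r3.

Hypothesis hxy : N%:Z < p - n \/ p - n = N%:Z /\ ((rb < rc)%N \/ rb = rc).
Hypothesis hyz : N%:Z < n - m \/ n - m = N%:Z /\ ((ra < rb)%N \/ ra = rb).

Lemma range12 (j k : nat) : (j < N.+1)%N -> (k < N.+1)%N ->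
  rel_range (p - j%:Z) (n - k%:Z) (m + j%:Z + k%:Z).
Proof. by move=> jN kN; split; lia. Qed.

Lemma range23 (i j : nat) : (i < N.+1)%N -> (j < N.+1)%N ->
  rel_range (n + i%:Z) (m + j%:Z) (p - i%:Z - j%:Z).
Proof. by move=> jN kN; split; lia. Qed.

Lemma range13 (i k : nat) : (i < N.+1)%N -> (k < N.+1)%N ->
  rel_range (p - i%:Z) (m + k%:Z) (n + i%:Z - k%:Z).
Proof. by move=> jN kN; split; lia. Qed.

Lemma left12 (j k : nat) : (j < N.+1)%N -> (k < N.+1)%N ->
  rel_left_le (m + j%:Z + k%:Z) ra (p - j%:Z) rc (n - k%:Z) rb.
Proof. by move=> jN kN; split; rewrite /lex3 /=; lia. Qed.

(** The indices excluded in [right12], [right23] and [right13] are those where the leading word may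
    be the top word itself: c(p) b(n) a(m), then b(p) a(n) c(m) when all generators agree and both
    gaps are [N], and c(p) a(n) b(m) when a = b and n - m = N. *)
Lemma right12 (j k : nat) : (j < N.+1)%N -> (k < N.+1)%N -> (j != 0) || (k != 0) ->
  rel_right_lt (p - j%:Z) rc (n - k%:Z) rb (m + j%:Z + k%:Z) ra.
Proof. by move=> jN kN jk; split; rewrite /lex3 /=; lia. Qed.

Lemma left23 (i j : nat) : (i < N.+1)%N -> (j < N.+1)%N ->
  rel_left_le (p - i%:Z - j%:Z) rc (n + i%:Z) rb (m + j%:Z) ra.
Proof. by move=> jN kN; split; rewrite /lex3 /=; lia. Qed.

Lemma right23 (i j : nat) : (i < N.+1)%N -> (j < N.+1)%N ->
    (i != N) || (j != N) || ~~ [&& p - n == N%:Z, n - m == N%:Z & (ra == rc)%N] ->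
  rel_right_lt (n + i%:Z) rb (m + j%:Z) ra (p - i%:Z - j%:Z) rc.
Proof. by move=> jN kN jk; split; rewrite /lex3 /=; lia. Qed.

Lemma left13 (i k : nat) : (i < N.+1)%N -> (k < N.+1)%N ->
  rel_left_le (n + i%:Z - k%:Z) rb (p - i%:Z) rc (m + k%:Z) ra.
Proof. by move=> jN kN; split; rewrite /lex3 /=; lia. Qed.

Lemma right13 (i k : nat) : (i < N.+1)%N -> (k < N.+1)%N ->
    (i != 0) || (k != N) || ~~ ((n - m == N%:Z) && (ra == rb)%N) ->
  rel_right_lt (p - i%:Z) rc (m + k%:Z) ra (n + i%:Z - k%:Z) rb.
Proof. by move=> jN kN jk; split; rewrite /lex3 /=; lia. Qed.

Lemma all_equal : p - n = N%:Z -> n - m = N%:Z -> ra = rc ->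
  [/\ rb = rc, n + N%:Z = p, m + N%:Z = n & p - N%:Z - N%:Z = m].
Proof. by move=> ? ? ?; split; lia. Qed.

Lemma top_equal : n - m = N%:Z -> m + N%:Z = n /\ n + 0%:Z - N%:Z = m.
Proof. by move=> ?; split; lia. Qed.

End LexArithmetic.

(** * Resolving the overlap of two bad pairs *)

Section Composition.
Variables (K : fieldType) (d : Order.disp_t) (B : orderType d) (N : nat).
Hypothesis charK : [pchar K] =i pred0.
Hypothesis N_gt0 : (0 < N)%N.
Local Notation X := (gen B).
Variables (A : algType K) (mon : seq X -> A).
Hypothesis mon_nil : mon [::] = 1.
Implicit Types (u v w : seq X) (x y z : X) (p q : A) (F : seq X).
Local Notation loc_rel := (loc_rel N mon).
Local Notation rho := (rho N mon).
Local Notation sgn := (sgnbin K N).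

(** For a bad pair n - m >= N, so all letters b(n-s), a(m+s) of its relator have indices between m
    and n. *)
Definition closed_letters F := forall (a b : B) (n m k : int),
  mkgen b n \in F -> mkgen a m \in F -> m <= k <= n ->
  (mkgen b k \in F) && (mkgen a k \in F).

(** [P] restricts the leading word of the multiple. With [P] the words below [W], the span is the
    part of the ideal modulo which an ambiguity at [W] must be resolved in the diamond lemma. *)
Definition rgen F (P : seq X -> Prop) p := exists u x y v,
  [/\ bad_pair N x y, all (mem F) (u ++ x :: y :: v), P (u ++ x :: y :: v) &
      p = mon u * rho x y * mon v].

(** Ranks in [nat] turn comparisons of generators into linear arithmetic. The rank of a generator
    counts the smaller ones in the list. *)
Lemma exists_rank (s : seq B) : exists r : B -> nat,
  {in s &, forall t t', (t < t')%O = (r t < r t')%N}.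
Proof.
pose r t := count (fun v : B => (v < t)%O) s; exists r.
have lt_r t t' : t \in s -> (t < t')%O -> (r t < r t')%N.
  move=> ts tu; apply: (count_lt (x := t)); rewrite ?ltxx //.
  by move=> v _ vt; apply: lt_trans tu.
move=> t t' ts ts'; have [tu|tu|->] := ltgtP t t'; last by rewrite ltnn.
  by rewrite lt_r.
by apply/esym/negbTE; rewrite -leqNgt ltnW // lt_r.
Qed.

Lemma lspan_sum2 (G : A -> Prop) (t : nat -> nat -> A) n j0 k0 r :
    (j0 < n)%N -> (k0 < n)%N ->
    (forall j k, (j < n)%N -> (k < n)%N -> (j != j0) || (k != k0) -> lspan G (t j k)) ->
    lspan G (t j0 k0 - r) ->
  lspan G (\sum_(0 <= j < n) \sum_(0 <= k < n) t j k - r).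
Proof.
move=> jn kn Gt Gr.
rewrite (bigD1_seq j0) ?mem_index_iota ?iota_uniq //=.
rewrite (bigD1_seq k0) ?mem_index_iota ?iota_uniq //=.
rewrite (addrAC _ _ (- r)) (addrAC _ _ (- r)); apply: lspanD; first apply: lspanD => //.
  apply: lspan_sum => k; rewrite mem_index_iota => /= kn' kk0.
  by apply: Gt; rewrite ?kk0 ?orbT.
apply: lspan_sum => j; rewrite mem_index_iota => /= jn' jj0; apply: lspan_sum => k.
by rewrite mem_index_iota => /= kn' _; apply: Gt; rewrite ?jj0.
Qed.

Lemma syzygy_cancel (V : zmodType) (t1 t2 r1 r2 r3 : V) :
  t1 - r1 + (t2 - r2) - (t1 + t2 - - r3) = - (r1 + r2 + r3).
Proof.
rewrite opprK !opprD !addrA [LHS](ACl ((1*5)*(3*6)*2*4*7))%AC /=.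
by rewrite !subrr !add0r.
Qed.

Section Triple.
Variables (F : seq X) (a b c : B) (m n p : int).
Hypothesis F_closed : closed_letters F.
Hypotheses (Fx : mkgen c p \in F) (Fy : mkgen b n \in F) (Fz : mkgen a m \in F).
Hypothesis bad_xy : bad_pair N (mkgen c p) (mkgen b n).
Hypothesis bad_yz : bad_pair N (mkgen b n) (mkgen a m).

Let x := mkgen c p.
Let y := mkgen b n.
Let z := mkgen a m.
Let lower := rgen F (fun w => wlt w [:: x; y; z]).
(** Besides lower multiples this admits the other side of the overlap, whose leading word is also
    [[:: x; y; z]]. *)
Let G g := g = mon [:: x] * rho y z \/ lower g.
Let l (t : B) (k : int) := mon [:: mkgen t k].

Let term12 i j k := (sgn i * sgn j * sgn k) *:
  comm (comm (l c (p - i%:Z - j%:Z)) (l b (n + i%:Z - k%:Z))) (l a (m + j%:Z + k%:Z)).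
Let term23 i j k := (sgn i * sgn j * sgn k) *:
  comm (comm (l b (n + i%:Z - k%:Z)) (l a (m + j%:Z + k%:Z))) (l c (p - i%:Z - j%:Z)).
Let term13 i j k := (sgn i * sgn j * sgn k) *:
  comm (comm (l c (p - i%:Z - j%:Z)) (l a (m + j%:Z + k%:Z))) (l b (n + i%:Z - k%:Z)).

Let rel12 j k := (sgn j * sgn k) *:
  comm (loc_rel c b (p - j%:Z) (n - k%:Z)) (l a (m + j%:Z + k%:Z)).
Let rel23 i j := (sgn i * sgn j) *:
  comm (loc_rel b a (n + i%:Z) (m + j%:Z)) (l c (p - i%:Z - j%:Z)).
Let rel13 i k := (sgn i * sgn k) *:
  comm (loc_rel c a (p - i%:Z) (m + k%:Z)) (l b (n + i%:Z - k%:Z)).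

(* The coefficient of the Jacobi identity for [c(z1)], [b(z2)], [a(z3)]
   multiplied by [(z1 - z2)^N (z1 - z3)^N (z2 - z3)^N]. *)
Let syzygy :
  \sum_(0 <= j < N.+1) \sum_(0 <= k < N.+1) rel12 j k +
  \sum_(0 <= i < N.+1) \sum_(0 <= j < N.+1) rel23 i j -
  \sum_(0 <= i < N.+1) \sum_(0 <= k < N.+1) rel13 i k = 0.
Proof.
transitivity (\sum_(0 <= i < N.+1) \sum_(0 <= j < N.+1) \sum_(0 <= k < N.+1)
  (term12 i j k + term23 i j k - term13 i j k)).
  (* Each family is summed innermost over the index of the factor that makes its inner pair local: i
     for c and b, k for b and a, j for c and a. *)
  under [RHS]eq_bigr => i _ do
    (under eq_bigr => j _ do rewrite sumrB big_split; rewrite sumrB big_split /=).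
  rewrite sumrB big_split /=; congr (_ + _ - _).
  - rewrite [RHS]exchange_big /=; apply: eq_bigr => j _.
    rewrite [RHS]exchange_big /=; apply: eq_bigr => k _.
    rewrite /rel12 /loc_rel comm_suml scaler_sumr; apply: eq_bigr => i _.
    rewrite commZl scalerA; congr (_ *: comm (comm (l c _) (l b _)) _).
    + by rewrite mulrC mulrA.
    + lia.
    + lia.
  - apply: eq_bigr => i _; apply: eq_bigr => j _.
    by rewrite /rel23 /loc_rel comm_suml scaler_sumr; apply: eq_bigr => k _;
      rewrite commZl scalerA.
  - apply: eq_bigr => i _; rewrite [RHS]exchange_big /=; apply: eq_bigr => k _.
    rewrite /rel13 /loc_rel comm_suml scaler_sumr; apply: eq_bigr => j _.
    rewrite commZl scalerA; congr (_ *: comm (comm _ (l a _)) _).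
    + by rewrite mulrAC.
    + lia.
rewrite big1 // => i _; rewrite big1 // => j _; rewrite big1 // => k _.
by rewrite -scalerDr -scalerBr comm_jacobi scaler0.
Qed.

Let s := [:: a; b; c].

Let sa : a \in s. Proof. by rewrite !inE eqxx. Qed.
Let sb : b \in s. Proof. by rewrite !inE eqxx orbT. Qed.
Let sc : c \in s. Proof. by rewrite !inE eqxx !orbT. Qed.

Let F_range t k : t \in s -> m <= k <= p -> mkgen t k \in F.
Proof.
move=> + kr; have /andP[mk kp] := kr; have [kn|/ltW nk] := leP k n; last first.
  have kr' : n <= k <= p by rewrite nk.
  have /andP[ck bk] := F_closed Fx Fy kr'; have /andP[_ ak] := F_closed Fx Fz kr.
  by rewrite !inE => /or3P[] /eqP->.
have kr' : m <= k <= n by rewrite mk.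
have /andP[bk ak] := F_closed Fy Fz kr'; have /andP[ck _] := F_closed Fx Fz kr.
by rewrite !inE => /or3P[] /eqP->.
Qed.

Variable r : B -> nat.
Hypothesis rlt : {in s &, forall t t', (t < t')%O = (r t < r t')%N}.

Let req t t' : t \in s -> t' \in s -> r t = r t' -> t = t'.
Proof.
move=> ts ts' E; have := rlt ts ts'; have := rlt ts' ts; rewrite E !ltnn.
by case: ltgtP.
Qed.

Local Notation lex3 := (lex3 p n m (r c) (r b) (r a)).

Let lex3_wlt k1 t1 k2 t2 k3 t3 : t1 \in s -> t2 \in s -> t3 \in s ->
  lex3 true k1 (r t1) k2 (r t2) k3 (r t3) ->
  wlt [:: mkgen t1 k1; mkgen t2 k2; mkgen t3 k3] [:: x; y; z].
Proof.
move=> s1 s2 s3; rewrite /wlt /= !gen_lt.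
case=> [->//|[-> [|[/(req s1 sc)-> H]]]]; first by rewrite -rlt // eqxx => ->; rewrite orbT.
rewrite !eqxx !ltxx /=.
case: H => [->//|[-> [|[/(req s2 sb)-> H]]]]; first by rewrite -rlt // eqxx => ->; rewrite orbT.
rewrite !eqxx !ltxx /=.
case: H => [->//|[->]]; rewrite addn0 -rlt // eqxx => ->.
by rewrite orbT.
Qed.

Let lex3_wle k1 t1 k2 t2 k3 t3 : t1 \in s -> t2 \in s -> t3 \in s ->
  lex3 false k1 (r t1) k2 (r t2) k3 (r t3) ->
  wle [:: mkgen t1 k1; mkgen t2 k2; mkgen t3 k3] [:: x; y; z].
Proof.
move=> s1 s2 s3 /lex3_le[?|[-> -> -> /(req s1 sc)-> [/(req s2 sb)-> /(req s3 sa)->]]].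
  exact/wltW/lex3_wlt.
exact: wle_refl.
Qed.

Let rel_mulr k1 t1 k2 t2 k3 t3 : t1 \in s -> t2 \in s -> t3 \in s ->
    rel_range N p m k1 k2 k3 ->
    rel_right_lt N p n m (r c) (r b) (r a) k1 (r t1) k2 (r t2) k3 (r t3) ->
  lspan G (loc_rel t1 t2 k1 k2 * l t3 k3).
Proof.
move=> s1 s2 s3 [in1 in2 in3 in2' in1'] [lt1 lt2].
apply: (loc_rel_rho charK N_gt0 (f := fun q => q * l t3 k3)) => [k q|bad|bad].
- by rewrite scalerAl.
- apply: lspan_gen; right; exists [::], (mkgen t1 k1), (mkgen t2 k2), [:: mkgen t3 k3].
  by rewrite mon_nil mul1r /= !F_range //; split=> //; apply: lex3_wlt.
apply: lspan_gen; right.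
exists [::], (mkgen t2 (k2 + N%:Z)), (mkgen t1 (k1 - N%:Z)), [:: mkgen t3 k3].
by rewrite mon_nil mul1r /= !F_range //; split=> //; apply: lex3_wlt.
Qed.

Let rel_mull k1 t1 k2 t2 k3 t3 : t1 \in s -> t2 \in s -> t3 \in s ->
    rel_range N p m k2 k3 k1 ->
    rel_left_le N p n m (r c) (r b) (r a) k1 (r t1) k2 (r t2) k3 (r t3) ->
  lspan G (l t1 k1 * loc_rel t2 t3 k2 k3).
Proof.
have gen e1 e2 e3 k1' k2' k3' : e1 \in s -> e2 \in s -> e3 \in s ->
    m <= k1' <= p -> m <= k2' <= p -> m <= k3' <= p ->
    bad_pair N (mkgen e2 k2') (mkgen e3 k3') ->
    lex3 false k1' (r e1) k2' (r e2) k3' (r e3) ->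
    lspan G (l e1 k1' * rho (mkgen e2 k2') (mkgen e3 k3')).
  move=> s1 s2 s3 in1 in2 in3 bad /(lex3_wle s1 s2 s3) le.
  apply: lspan_gen; case/predU1P: le => [[-> -> -> -> -> ->]|lt]; first by left.
  right; exists [:: mkgen e1 k1'], (mkgen e2 k2'), (mkgen e3 k3'), [::].
  by rewrite mon_nil mulr1 /= !F_range.
move=> s1 s2 s3 [in2 in3 in1 in3' in2'] [le1 le2].
apply: (loc_rel_rho charK N_gt0 (f := fun q => l t1 k1 * q)) => [k q|bad|bad].
- by rewrite scalerAr.
- exact: gen.
- exact: gen.
Qed.

Let hxy : N%:Z < p - n \/
  p - n = N%:Z /\ ((r b < r c)%N \/ r b = r c).
Proof.
move: bad_xy; rewrite /bad_pair /= rlt // => /orP[|/andP[/eqP -> /orP[|/andP[/eqP-> _]]]].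
- by left.
- by right; split=> //; left.
- by right; split=> //; right.
Qed.

Let hyz : N%:Z < n - m \/
  n - m = N%:Z /\ ((r a < r b)%N \/ r a = r b).
Proof.
move: bad_yz; rewrite /bad_pair /= rlt // => /orP[|/andP[/eqP -> /orP[|/andP[/eqP-> _]]]].
- by left.
- by right; split=> //; left.
- by right; split=> //; right.
Qed.


Let mull12 j k : (j < N.+1)%N -> (k < N.+1)%N ->
  lspan G (l a (m + j%:Z + k%:Z) * loc_rel c b (p - j%:Z) (n - k%:Z)).
Proof. by move=> jN kN; apply: rel_mull => //; [apply: (range12 hxy hyz)|apply: (left12 hxy hyz)]. Qed.

Let mull23 i j : (i < N.+1)%N -> (j < N.+1)%N ->
  lspan G (l c (p - i%:Z - j%:Z) * loc_rel b a (n + i%:Z) (m + j%:Z)).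
Proof. by move=> iN jN; apply: rel_mull => //; [apply: (range23 hxy hyz)|apply: (left23 hxy hyz)]. Qed.

Let mull13 i k : (i < N.+1)%N -> (k < N.+1)%N ->
  lspan G (l b (n + i%:Z - k%:Z) * loc_rel c a (p - i%:Z) (m + k%:Z)).
Proof. by move=> iN kN; apply: rel_mull => //; [apply: (range13 hxy hyz)|apply: (left13 hxy hyz)]. Qed.

(* [rho x y * z] occurs in [rel12 0 0] and, if some of the letters have the same
   generator, also in [rel23 N N] and [rel13 0 N]; as these occurrences add up with
   the same sign, they do not cancel in characteristic zero. *)
Let rel12_bound : exists2 k, (0 < k)%N &
  lspan G (\sum_(0 <= j < N.+1) \sum_(0 <= k < N.+1) rel12 j k -
           k%:R *: (rho x y * mon [:: z])).
Proof.
have [k k0 kE] := loc_rel_bad charK mon bad_xy; exists k => //.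
apply: (lspan_sum2 (j0 := 0) (k0 := 0)) => // [i j iN jN ij0|].
  rewrite /rel12; apply: lspanZ; apply: lspanB; last exact: mull12.
  by apply: rel_mulr => //; [apply: (range12 hxy hyz)|apply: (right12 hxy hyz)].
rewrite /rel12 sgnbin0 mulr1 scale1r; have := mull12 (ltn0Sn N) (ltn0Sn N).
have sub0 (t : int) : t - 0%:Z = t by exact: subr0.
have add0 (t : int) : t + 0%:Z = t by exact: addr0.
rewrite !sub0 ?add0 /comm kE -scalerAl addrAC subrr sub0r; exact: lspanN.
Qed.

Let rel23_bound : exists k : nat,
  lspan G (\sum_(0 <= i < N.+1) \sum_(0 <= j < N.+1) rel23 i j -
           k%:R *: (rho x y * mon [:: z])).
Proof.
have mulr i j : (i < N.+1)%N -> (j < N.+1)%N ->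
    (i != N) || (j != N) || ~~ [&& p - n == N%:Z, n - m == N%:Z & (r a == r c)%N] ->
    lspan G (loc_rel b a (n + i%:Z) (m + j%:Z) * l c (p - i%:Z - j%:Z)).
  by move=> iN jN ijN; apply: rel_mulr => //; [apply: (range23 hxy hyz)|apply: (right23 hxy hyz)].
have [|nE] := boolP [&& p - n == N%:Z, n - m == N%:Z & (r a == r c)%N]; last first.
  exists 0%N; rewrite scale0r subr0; apply: lspan_sum => i; rewrite mem_index_iota => /= iN _.
  apply: lspan_sum => j; rewrite mem_index_iota => /= jN _.
  rewrite /rel23; apply: lspanZ; apply: lspanB; last exact: mull23.
  by apply: mulr; rewrite ?nE ?orbT.
case/and3P=> /eqP pn /eqP nm /eqP rac.
have [k _ kE] := loc_rel_bad charK mon bad_xy; exists k.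
apply: (lspan_sum2 (j0 := N) (k0 := N)) => // [i j iN jN ijN|].
  rewrite /rel23; apply: lspanZ; apply: lspanB; last exact: mull23.
  by apply: mulr; rewrite ?ijN.
have [/(req sb sc) bc E1 E2 E3] := all_equal hxy hyz pn nm rac.
have ac : a = c by apply: req.
have Er : loc_rel b a (n + N%:Z) (m + N%:Z) = k%:R *: rho x y.
  by rewrite E1 E2 -kE bc ac.
have El : l c (p - N%:Z - N%:Z) = mon [:: z] by rewrite E3 /l /z ac.
have := mull23 (ltnSn N) (ltnSn N); rewrite /rel23 sgnbinN -expr2 sqrr_sign scale1r.
by rewrite /comm Er El -scalerAl addrAC subrr sub0r; apply: lspanN.
Qed.

Let rel13_bound : exists k : nat,
  lspan G (\sum_(0 <= i < N.+1) \sum_(0 <= k < N.+1) rel13 i k -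
           - (k%:R *: (rho x y * mon [:: z]))).
Proof.
have mulr i j : (i < N.+1)%N -> (j < N.+1)%N ->
    (i != 0) || (j != N) || ~~ ((n - m == N%:Z) && (r a == r b)%N) ->
    lspan G (loc_rel c a (p - i%:Z) (m + j%:Z) * l b (n + i%:Z - j%:Z)).
  by move=> iN jN ijN; apply: rel_mulr => //; [apply: (range13 hxy hyz)|apply: (right13 hxy hyz)].
have [|nE] := boolP ((n - m == N%:Z) && (r a == r b)%N); last first.
  exists 0%N; rewrite scale0r oppr0 subr0; apply: lspan_sum => i; rewrite mem_index_iota => /= iN _.
  apply: lspan_sum => j; rewrite mem_index_iota => /= jN _.
  rewrite /rel13; apply: lspanZ; apply: lspanB; last exact: mull13.
  by apply: mulr; rewrite ?nE ?orbT.
case/andP=> /eqP nm /eqP/(req sa sb) ab.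
have [k _ kE] := loc_rel_bad charK mon bad_xy; exists k.
apply: (lspan_sum2 (j0 := 0) (k0 := N)) => // [i j iN jN ijN|].
  rewrite /rel13; apply: lspanZ; apply: lspanB; last exact: mull13.
  by apply: mulr; rewrite ?ijN.
have [E1 E2] := top_equal hxy hyz nm.
(* The bad pair [y z] has equal generators and gap [N], so [N] is odd and the coefficient at (0, N)
   is -1. As [rel13] enters the syzygy with a minus sign, this occurrence also counts positively. *)
have oddN : odd N.
  have := bad_yz; rewrite /bad_pair /= nm ltxx eqxx ab eqxx ltxx.
  by case/andP.
have Er : loc_rel c a (p - 0%:Z) (m + N%:Z) = k%:R *: rho x y.
  by rewrite E1 -kE ab; congr loc_rel; apply: subr0.
have El : l b (n + 0%:Z - N%:Z) = mon [:: z] by rewrite E2 /l /z ab.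
have := mull13 (ltn0Sn N) (ltnSn N).
rewrite /rel13 sgnbin0 sgnbinN mul1r -signr_odd oddN expr1 scaleN1r.
by rewrite /comm Er El -scalerAl opprK opprB subrK.
Qed.

Lemma composition_core_triple : lspan G (rho x y * mon [:: z]).
Proof.
have [k1 k1_gt0 S1] := rel12_bound; have [k2 S2] := rel23_bound.
have [k3 S3] := rel13_bound.
have := lspanB (lspanD S1 S2) S3; set R := rho x y * _; move: syzygy.
set T1 := \sum_(_ <= _ < _) _; set T2 := \sum_(_ <= _ < _) _; set T3 := \sum_(_ <= _ < _) _.
move=> E; have -> : T1 - k1%:R *: R + (T2 - k2%:R *: R) - (T3 - - (k3%:R *: R)) =
    - ((k1 + k2 + k3)%:R *: R).
  rewrite !natrD !scalerDl (_ : T3 = T1 + T2); first exact: syzygy_cancel.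
  by apply/eqP; rewrite eq_sym -subr_eq0 E.
move/lspanN; rewrite opprK => /(lspanZ (k1 + k2 + k3)%:R^-1).
rewrite scalerA mulVf ?scale1r //.
by rewrite natK_neq0 // -addnA addn_gt0 k1_gt0.
Qed.
End Triple.
End Composition.

(** * Leading words of the ideal of relators *)

Section Diamond.
Variables (K : fieldType) (d : Order.disp_t) (B : orderType d) (N : nat).
Hypothesis charK : [pchar K] =i pred0.
Hypothesis N_gt0 : (0 < N)%N.
Local Notation X := (gen B).
Variable A : freeAlgebra K X.
Local Notation mon := (mon A).
Local Notation loc_rel := (loc_rel N mon).
Local Notation rho := (rho N mon).
Local Notation rgen := (rgen N mon).
Implicit Types (u v w : seq X) (x y z : X) (p q f : A).
Variable F : seq X.
Hypothesis F_closed : closed_letters F.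

Lemma comm_mon x y : comm (mon [:: x]) (mon [:: y]) = mon [:: x; y] - mon [:: y; x].
Proof. by rewrite /comm !monM. Qed.

Lemma rho_lead x y : bad_pair N x y -> x \in F -> y \in F -> lead F [:: x; y] (rho x y).
Proof.
case: x y => n b [m a] bad Fx Fy.
have nm : N%:Z <= n - m by move: bad; rewrite /bad_pair; lia.
have nm0 : m < n by lia.
have Fm k : m <= k <= n -> (mkgen b k \in F) && (mkgen a k \in F) by apply: F_closed.
pose W := [:: mkgen b n; mkgen a m].
have below_swap (s : nat) : (s <= N)%N -> m + s%:Z < n \/ m + s%:Z = n /\ (a < b)%O ->
    below F W [:: mkgen a (m + s%:Z); mkgen b (n - s%:Z)].
  move=> sN lt; have /andP[_ Fa] : (mkgen b (m + s%:Z) \in F) && (mkgen a (m + s%:Z) \in F).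
    by apply: Fm; lia.
  have /andP[Fb _] : (mkgen b (n - s%:Z) \in F) && (mkgen a (n - s%:Z) \in F).
    by apply: Fm; lia.
  rewrite /below /= Fa Fb /wlt /= gen_lt.
  by case: lt => [->//|[-> ->]]; rewrite eqxx orbT.
have below_comm (s : nat) : (0 < s <= N)%N -> m + s%:Z < n \/ m + s%:Z = n /\ (a < b)%O ->
    supp_in (below F W) (comm (mon [:: mkgen b (n - s%:Z)]) (mon [:: mkgen a (m + s%:Z)])).
  move=> /andP[s0 sN] lt; rewrite comm_mon; apply: supp_inB; last first.
    by apply: supp_in_mon; apply: below_swap.
  apply: supp_in_mon.
  have /andP[_ Fa] : (mkgen b (m + s%:Z) \in F) && (mkgen a (m + s%:Z) \in F).
    by apply: Fm; lia.
  have /andP[Fb _] : (mkgen b (n - s%:Z) \in F) && (mkgen a (n - s%:Z) \in F).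
    by apply: Fm; lia.
  rewrite /below /= Fa Fb /wlt /= gen_lt.
  by have -> : n - s%:Z < n by lia.
have add0 : m + 0%:Z = m by exact: addr0.
have sub0 : n - 0%:Z = n by exact: subr0.
have comm0 : supp_in (below F W)
    (comm (mon [:: mkgen b n]) (mon [:: mkgen a m]) - mon W).
  rewrite comm_mon [X in supp_in _ X]addrAC subrr sub0r; apply: supp_inN; apply: supp_in_mon.
  have := below_swap 0%N (leq0n N); rewrite add0 sub0; by apply; left.
rewrite /lead /rho /=.
have [/andP[/eqP nmE /eqP ba]|nspec] := boolP ((n - m == N%:Z) && (b == a)).
  have oddN : odd N.
    by move: bad; rewrite /bad_pair nmE ltxx eqxx ba eqxx ltxx => /andP[].
  have E1 : n - N%:Z = m by lia.
  have E2 : m + N%:Z = n by lia.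
  rewrite /loc_rel big_nat_recr //= big_ltn // sgnbin0 scale1r sub0 add0.
  rewrite sgnbinN -signr_odd oddN expr1 scaleN1r E1 E2 ba.
  rewrite (comm_antisym (mon [:: mkgen a m])) opprK addrAC -mulr2n scalerDr -scaler_nat scalerA mulVf ?scale1r; last exact: natK_neq0.
  rewrite addrAC; apply: supp_inD; first by move: comm0; rewrite /W ba.
  apply: supp_inZ; apply: supp_in_sum => s; rewrite mem_index_iota => /andP[s0 sN].
  apply: supp_inZ; rewrite -ba; have := below_comm s; rewrite /W ba; apply.
    by rewrite s0 ltnW.
  by left; lia.
rewrite scale1r /loc_rel big_ltn // sgnbin0 scale1r sub0 add0 addrAC.
apply: supp_inD comm0 _; apply: supp_in_sum => s; rewrite mem_index_iota => /andP[s0 sN].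
apply: supp_inZ; apply: below_comm; first by rewrite s0 -ltnS.
move: bad nspec; rewrite /bad_pair /=; have [->|ba] := eqVneq b a.
  by rewrite ltxx andbT; lia.
rewrite andbF orbF => /orP[lt|/andP[/eqP nmE ab]] _; first by left; lia.
by have [sE|sN'] := eqVneq s N; [right; split=> //; lia|left; lia].
Qed.

Lemma rgen_lead u x y v : bad_pair N x y -> all (mem F) (u ++ x :: y :: v) ->
  lead F (u ++ x :: y :: v) (mon u * rho x y * mon v).
Proof.
move=> bad; rewrite all_cat /= => /and4P[Fu Fx Fy Fv].
rewrite -[x :: y :: v]/([:: x; y] ++ v) catA; apply: leadM => //.
- by rewrite all_cat Fu /= Fx Fy.
- apply: leadM => //; first by rewrite /= Fx Fy.
    exact: lead_mon.
  exact: rho_lead.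
exact: lead_mon.
Qed.

Lemma rgen_supp (P : seq X -> Prop) W f :
  (forall w, P w -> wle w W) -> lspan (rgen F P) f -> supp_in (fun w => wle w W) f.
Proof.
move=> PW; elim=> [|c g h [u [x [y [v [bad Fw Pw ->]]]]] _ IH].
  exact: supp_in0.
apply: supp_inD IH; apply: supp_inZ.
apply: supp_in_sub (lead_supp (rgen_lead bad Fw)) => w.
by move/wle_trans; apply; apply: PW.
Qed.

Lemma rgen_supp_lt W f : lspan (rgen F (fun w => wlt w W)) f -> wcoef W f = 0.
Proof.
elim=> [|c g h [u [x [y [v [bad Fw Pw ->]]]]] _ IH]; first exact: wcoef0.
rewrite wcoefD wcoefZ IH addr0; apply/eqP; rewrite mulf_eq0; apply/orP; right.
apply/negPn/negP => /(lead_supp (rgen_lead bad Fw)).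
by rewrite wleNgt Pw.
Qed.

Lemma rgen_mul u v W f : all (mem F) u -> all (mem F) v ->
    lspan (rgen F (fun w => wlt w W)) f ->
  lspan (rgen F (fun w => wlt w (u ++ W ++ v))) (mon u * f * mon v).
Proof.
move=> Fu Fv; apply: (lspan_map (f := fun g => mon u * g * mon v)).
- by rewrite mulr0 mul0r.
- by move=> c g h; rewrite mulrDr mulrDl -scalerAr -scalerAl.
move=> _ [u' [x [y [v' [bad Fw Pw ->]]]]].
apply: lspan_gen; exists (u ++ u'), x, y, (v' ++ v); split=> //.
- move: Fw; rewrite !all_cat /= all_cat Fu Fv => /andP[-> /and3P[-> -> ->]].
  by [].
- have -> : (u ++ u') ++ x :: y :: v' ++ v = u ++ (u' ++ x :: y :: v') ++ v.
    by rewrite -!catA.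
  exact: wlt_cat.
by rewrite -!monM !mulrA.
Qed.

(* The two sides have the same leading coefficient, so [composition_core_triple]
   determines the coefficient of [mon [:: x] * rho y z]. *)
Lemma composition x y z : x \in F -> y \in F -> z \in F ->
    bad_pair N x y -> bad_pair N y z ->
  lspan (rgen F (fun w => wlt w [:: x; y; z]))
    (rho x y * mon [:: z] - mon [:: x] * rho y z).
Proof.
move=> Fx Fy Fz bxy byz.
have [r rP] := exists_rank [:: z.2; y.2; x.2].
have core : lspan (fun g => g = mon [:: x] * rho y z \/
    rgen F (fun w => wlt w [:: x; y; z]) g) (rho x y * mon [:: z]).
  case: x y z Fx Fy Fz bxy byz rP => [p c] [n b] [m a] Fx Fy Fz bxy byz rP.
  exact: (composition_core_triple charK N_gt0 (mon_nil A) F_closed Fx Fy Fz bxy byz rP).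
have [e Se] : exists e, lspan (rgen F (fun w => wlt w [:: x; y; z]))
    (rho x y * mon [:: z] - e *: (mon [:: x] * rho y z)).
  elim: core => [|k g h Gg _ [e Se]].
    by exists 0; rewrite scale0r subr0; apply: lspan0.
  case: Gg => [->|Gg].
    by exists (k + e); rewrite scalerDl opprD addrACA subrr add0r.
  by exists e; rewrite -addrA; apply: lspanDZ.
suff e1 : e = 1 by rewrite e1 scale1r in Se.
have := rgen_supp_lt Se; rewrite wcoefB wcoefZ.
have -> : wcoef [:: x; y; z] (rho x y * mon [:: z]) = 1.
  have := rgen_lead (u := [::]) (v := [:: z]) bxy.
  by rewrite /= Fx Fy Fz mon_nil mul1r => /(_ isT)/wlead_coef.
have -> : wcoef [:: x; y; z] (mon [:: x] * rho y z) = 1.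
  have := rgen_lead (u := [:: x]) (v := [::]) byz.
  by rewrite /= Fx Fy Fz mon_nil mulr1 => /(_ isT)/wlead_coef.
by rewrite mulr1 => /eqP; rewrite subr_eq0 => /eqP.
Qed.

(** Both sides differ from the product [rho x y * mon t * rho x' y'] by a relator times the tail of
    the other one, and such terms have smaller leading words. *)
Lemma rgen_disjoint x y t x' y' : bad_pair N x y -> bad_pair N x' y' ->
    all (mem F) ([:: x; y] ++ t ++ [:: x'; y']) ->
  lspan (rgen F (fun w => wlt w ([:: x; y] ++ t ++ [:: x'; y'])))
    (rho x y * mon (t ++ [:: x'; y']) - mon ([:: x; y] ++ t) * rho x' y').
Proof.
move=> b b'; rewrite !all_cat => /and3P[/= /and3P[Fx Fy _] Ft /and3P[Fx' Fy' _]].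
have L := rho_lead b Fx Fy; have L' := rho_lead b' Fx' Fy'.
have -> : rho x y * mon (t ++ [:: x'; y']) - mon ([:: x; y] ++ t) * rho x' y' =
    (rho x y - mon [:: x; y]) * (mon t * rho x' y') -
    rho x y * mon t * (rho x' y' - mon [:: x'; y']).
  by rewrite mulrBl mulrBr opprB -!monM !mulrA [RHS]addrC addrA subrK.
apply: lspanB.
  move/supp_in_lspan: L; apply: (lspan_map (f := fun r => r * (mon t * rho x' y'))).
  - by rewrite mul0r.
  - by move=> c r s; rewrite mulrDl scalerAl.
  move=> _ [w /andP[Fw lt] ->]; apply: lspan_gen; exists (w ++ t), x', y', [::].
  split=> //; first by rewrite !all_cat Fw Ft /= Fx' Fy'.
    by move: (wlt_cat2r (t ++ [:: x'; y']) lt); rewrite catA.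
  by rewrite mon_nil mulr1 mulrA monM.
move/supp_in_lspan: L'; apply: (lspan_map (f := fun r => rho x y * mon t * r)).
- by rewrite mulr0.
- by move=> c r s; rewrite mulrDr scalerAr.
move=> _ [w /andP[Fw lt] ->]; apply: lspan_gen; exists [::], x, y, (t ++ w).
split=> //; first by rewrite /= Fx Fy all_cat Ft.
  by move: (wlt_cat2l ([:: x; y] ++ t) lt); rewrite -!catA.
by rewrite mon_nil mul1r -mulrA monM.
Qed.

Lemma ambiguity_nested u x y v s x' y' v' : bad_pair N x y -> bad_pair N x' y' ->
    all (mem F) (u ++ x :: y :: v) -> x :: y :: v = s ++ x' :: y' :: v' ->
  lspan (rgen F (fun w => wlt w (u ++ x :: y :: v)))
    (mon u * rho x y * mon v - mon (u ++ s) * rho x' y' * mon v').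
Proof.
(* The offset between the two bad pairs is zero (the same relator), one (an overlap in one letter),
   or larger (disjoint). *)
case: s => [|x3 [|y3 t]] b b' Fw [].
- by move=> <- <- <-; rewrite cats0 subrr; apply: lspan0.
- move=> <- E1 E2; rewrite -{x'}E1 {v}E2 in b' Fw *.
  move: Fw; rewrite all_cat /= => /and5P[Fu Fx Fy Fy' Fv].
  have := rgen_mul Fu Fv (composition Fx Fy Fy' b b').
  rewrite -[y' :: v']cat1s -!monM mulrBr mulrBl !mulrA; exact.
move=> <- <- E; rewrite {v}E in Fw *.
move: Fw; rewrite all_cat /= all_cat /=.
move=> /and4P[Fu Fx Fy /and4P[Ft Fx' Fy' Fv]].
have Fm : all (mem F) ([:: x; y] ++ t ++ [:: x'; y']).
  by rewrite !all_cat /= Fx Fy Ft Fx' Fy'.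
have := rgen_mul Fu Fv (rgen_disjoint b b' Fm).
have -> : x :: y :: t ++ x' :: y' :: v' = ([:: x; y] ++ t ++ [:: x'; y']) ++ v'.
  by rewrite -!catA.
have -> : t ++ x' :: y' :: v' = (t ++ [:: x'; y']) ++ v' by rewrite -catA.
rewrite -[x :: y :: t]/([:: x; y] ++ t) -(monM _ (t ++ _)) -(monM _ u).
by rewrite mulrBr mulrBl !mulrA.
Qed.

Lemma ambiguity u x y v u' x' y' v' :
    bad_pair N x y -> bad_pair N x' y' -> all (mem F) (u ++ x :: y :: v) ->
    u ++ x :: y :: v = u' ++ x' :: y' :: v' ->
  lspan (rgen F (fun w => wlt w (u ++ x :: y :: v)))
    (mon u * rho x y * mon v - mon u' * rho x' y' * mon v').
Proof.
move=> b b' Fw E; case/cat_eq_splitP: (E) => [] [s [uE vE]]; last first.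
  by rewrite uE; apply: ambiguity_nested.
rewrite E in Fw *; rewrite uE -opprB; apply: lspanN.
exact: ambiguity_nested.
Qed.

(** By [ambiguity], all multiples with leading word [W] agree modulo lower ones, so they merge into
    a single one and their coefficients add up. *)
Lemma rgen_decomp W f : lspan (rgen F (fun w => wle w W)) f ->
  lspan (rgen F (fun w => wlt w W)) f \/
  exists u x y v c, [/\ bad_pair N x y, all (mem F) W, W = u ++ x :: y :: v &
    lspan (rgen F (fun w => wlt w W)) (f - c *: (mon u * rho x y * mon v))].
Proof.
elim=> [|c g h [u [x [y [v [bad Fw /predU1P Pw ->]]]]] _ IH].
  by left; apply: lspan0.
case: Pw => [WE|lt]; last first.
  have G : lspan (rgen F (fun w => wlt w W)) (c *: (mon u * rho x y * mon v)).
    by apply/lspanZ/lspan_gen; exists u, x, y, v.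
  case: IH => [IH|[u' [x' [y' [v' [c' [bad' FW' W' IH]]]]]]].
    by left; apply: lspanD.
  right; exists u', x', y', v', c'; split=> //.
  by rewrite -addrA; apply: lspanD.
right; exists u, x, y, v; rewrite WE in Fw.
case: IH => [IH|[u' [x' [y' [v' [c' [bad' FW' W' IH]]]]]]].
  by exists c; split=> //; rewrite addrAC subrr add0r.
exists (c + c'); split=> //; rewrite scalerDl opprD addrA [_ + h - _]addrAC subrr add0r.
rewrite -[h](subrK (c' *: (mon u' * rho x' y' * mon v'))) -addrA.
apply: lspanD => //; rewrite -scalerBr; apply: lspanZ.
by rewrite W'; apply: ambiguity => //; rewrite -W' // WE.
Qed.

Lemma rgen_lt_le (P : seq X -> Prop) f : lspan (rgen F P) f ->
  f = 0 \/ exists2 W, P W /\ all (mem F) W & lspan (rgen F (fun w => wle w W)) f.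
Proof.
elim=> [|c g h [u [x [y [v [bad Fw Pw ->]]]]] _ IH]; first by left.
right; set W0 := u ++ x :: y :: v in Fw Pw.
have G W : wle W0 W -> lspan (rgen F (fun w => wle w W)) (c *: (mon u * rho x y * mon v)).
  by move=> W0W; apply/lspanZ/lspan_gen; exists u, x, y, v.
case: IH => [->|[W [PW FW] SW]].
  by exists W0 => //; rewrite addr0; apply/G/wle_refl.
have [le|] := boolP (wle W0 W).
  by exists W => //; apply: lspanD => //; apply: G.
rewrite wleNgt negbK => lt; exists W0 => //; apply: lspanD; first exact/G/wle_refl.
apply: lspan_sub SW => _ [u' [x' [y' [v' [bad' Fw' Pw' ->]]]]].
apply: lspan_gen; exists u', x', y', v'; split=> //.
exact/wltW/(wle_lt_trans Pw').
Qed.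

Lemma bad_not_terminal u x y v : bad_pair N x y -> ~~ terminal N (u ++ x :: y :: v).
Proof.
move=> bad; rewrite /terminal; case: u => [|z u] /=; first by rewrite bad.
by rewrite cat_path /= bad !andbF.
Qed.

(** The conclusion of the diamond lemma. If the merged coefficient at the bound [W] is nonzero, [W]
    is the leading word and contains a bad pair; otherwise the bound drops, which can happen only
    finitely often over [F]. *)
Theorem ideal_lead_not_terminal f : lspan (rgen F (fun _ => True)) f ->
  f = 0 \/ exists W, [/\ ~~ terminal N W, wcoef W f != 0 & supp_in (fun w => wle w W) f].
Proof.
case/rgen_lt_le => [->|[W [_ FW] SW]]; first by left.
elim/wlt_ind: W / FW f SW => W FW IH f SW.
have [SW'|] := rgen_decomp SW.
  case/rgen_lt_le: SW' => [->|[V [VW FV] SV]]; first by left.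
  exact: IH VW _ SV.
move=> [u [x [y [v [c [bad _ WE S]]]]]].
have [c0|c0] := eqVneq c 0.
  rewrite c0 scale0r subr0 in S.
  case/rgen_lt_le: S => [->|[V [VW FV] SV]]; first by left.
  exact: IH VW _ SV.
right; exists W; split; first by rewrite WE; apply: bad_not_terminal.
  have /eqP := rgen_supp_lt S; rewrite wcoefB subr_eq0 => /eqP->.
  by rewrite wcoefZ {1}WE (wlead_coef (rgen_lead bad _)) ?mulr1 -?WE.
exact: rgen_supp SW.
Qed.

End Diamond.

(** * Linear independence in U(L) *)

Section Letters.
Variables (d : Order.disp_t) (B : orderType d).
Local Notation X := (gen B).

Definition letters M (cs : seq B) : seq X :=
  [seq mkgen c (i%:Z - M%:Z) | i <- iota 0 (M + M + 1), c <- cs].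

Lemma mem_letters M cs c k : (mkgen c k \in letters M cs) = (`|k| <= M)%N && (c \in cs).
Proof.
apply/allpairsP/andP => [[[i e] /= [+ + [-> ->]]]|[kM ccs]].
  by rewrite mem_iota => i_le ->; split=> //; lia.
by exists (absz (k + M%:Z), c); split=> //=; [rewrite mem_iota|congr pair]; lia.
Qed.

Lemma letters_closed M cs : closed_letters (letters M cs).
Proof.
move=> a b n m k; rewrite !mem_letters => /andP[nM ->] /andP[mM ->] kr.
by rewrite !andbT andbb; lia.
Qed.

Lemma letters_sub M M' cs cs' : (M <= M')%N -> {subset cs <= cs'} ->
  {subset letters M cs <= letters M' cs'}.
Proof.
move=> MM' cc [k c]; rewrite !mem_letters => /andP[kM /cc->].
by rewrite andbT (leq_trans kM).
Qed.

Lemma letters_cover w : exists M cs, all (mem (letters M cs)) w.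
Proof.
elim: w => [|[k c] w [M [cs IH]]]; first by exists 0%N, [::].
exists (maxn M `|k|), (c :: cs); rewrite /= mem_letters leq_maxr mem_head /=.
apply: sub_all IH => x; apply: letters_sub; first exact: leq_maxl.
by move=> e; rewrite inE orbC => ->.
Qed.

Lemma letters_join M cs M' cs' : exists M2 cs2,
  {subset letters M cs <= letters M2 cs2} /\ {subset letters M' cs' <= letters M2 cs2}.
Proof.
exists (maxn M M'), (cs ++ cs'); split; apply: letters_sub.
- exact: leq_maxl.
- by move=> x; rewrite mem_cat => ->.
- exact: leq_maxr.
- by move=> x; rewrite mem_cat orbC => ->.
Qed.

End Letters.

(** * The two-sided ideal of relators and the kernel of the projection *)

Section LocalityIdeal.
Variables (K : fieldType) (d : Order.disp_t) (B : orderType d) (N : nat).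
Hypothesis charK : [pchar K] =i pred0.
Hypothesis N_gt0 : (0 < N)%N.
Local Notation X := (gen B).
Variable A : freeAlgebra K X.
Local Notation mon := (mon A).
Local Notation loc_rel := (loc_rel N mon).
Local Notation rho := (rho N mon).
Local Notation rgen := (rgen N mon).
Implicit Types (u v w : seq X) (x y z : X) (p q r f : A) (F : seq X).

Inductive loc_ideal : A -> Prop :=
| loc_ideal_rel b a n m : loc_ideal (loc_rel b a n m)
| loc_ideal0 : loc_ideal 0
| loc_idealD p q of loc_ideal p & loc_ideal q : loc_ideal (p + q)
| loc_idealZ (c : K) p of loc_ideal p : loc_ideal (c *: p)
| loc_idealMl p q of loc_ideal q : loc_ideal (p * q)
| loc_idealMr p q of loc_ideal p : loc_ideal (p * q).

Lemma loc_idealN p : loc_ideal p -> loc_ideal (- p).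
Proof. by rewrite -scaleN1r; apply: loc_idealZ. Qed.

Definition eqmod p q := loc_ideal (p - q).

Lemma eqmod_refl p : eqmod p p.
Proof. by rewrite /eqmod subrr; apply: loc_ideal0. Qed.

Lemma eqmod_sym p q : eqmod p q -> eqmod q p.
Proof. by move/loc_idealN; rewrite opprB. Qed.

Lemma eqmod_trans q p r : eqmod p q -> eqmod q r -> eqmod p r.
Proof. by move=> /loc_idealD H /H; rewrite addrA subrK. Qed.

Lemma eqmodD p p' q q' : eqmod p p' -> eqmod q q' -> eqmod (p + q) (p' + q').
Proof. by move=> Hp Hq; rewrite /eqmod opprD addrACA; apply: loc_idealD. Qed.

Lemma eqmodZ (c : K) p p' : eqmod p p' -> eqmod (c *: p) (c *: p').
Proof. by move=> Hp; rewrite /eqmod -scalerBr; apply: loc_idealZ. Qed.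

Lemma eqmodN p p' : eqmod p p' -> eqmod (- p) (- p').
Proof. by rewrite -!scaleN1r; apply: eqmodZ. Qed.

Lemma eqmodM p p' q q' : eqmod p p' -> eqmod q q' -> eqmod (p * q) (p' * q').
Proof.
move=> Hp Hq; apply: (@eqmod_trans (p' * q)).
  by rewrite /eqmod -mulrBl; apply: loc_idealMr.
by rewrite /eqmod -mulrBr; apply: loc_idealMl.
Qed.

Lemma eqmod_comm p p' q q' : eqmod p p' -> eqmod q q' -> eqmod (comm p q) (comm p' q').
Proof. by move=> Hp Hq; apply: eqmodD; [|apply: eqmodN]; apply: eqmodM. Qed.

Fixpoint lie_term_eval (t : lie_term K X) : A :=
  match t with
  | LGen x => mon [:: x]
  | LZero => 0
  | LOpp s => - lie_term_eval s
  | LAdd s u => lie_term_eval s + lie_term_eval u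
  | LScale c s => c *: lie_term_eval s
  | LBr s u => comm (lie_term_eval s) (lie_term_eval u)
  end.

Lemma lie_term_eval_locality b a n m :
  lie_term_eval (locality_sum K N b a n m) = loc_rel b a n m.
Proof. exact: (big_morph lie_term_eval). Qed.

Lemma lie_cong_eval s t : lie_cong (@locality_rel K d B N) s t ->
  eqmod (lie_term_eval s) (lie_term_eval t).
Proof.
elim=> {s t} /=.
- move=> t [b [a [n [m ->]]]]; rewrite lie_term_eval_locality /eqmod subr0.
  exact: loc_ideal_rel.
- by move=> t; apply: eqmod_refl.
- by move=> s t _; apply: eqmod_sym.
- by move=> s t u _ H1 _; apply: eqmod_trans.
- by move=> s s' _; apply: eqmodN.
- by move=> s s' t t' _ H1 _; apply: eqmodD.
- by move=> c s s' _; apply: eqmodZ.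
- by move=> s s' t t' _ H1 _; apply: eqmod_comm.
- by move=> s t u; rewrite addrA; apply: eqmod_refl.
- by move=> s t; rewrite addrC; apply: eqmod_refl.
- by move=> s; rewrite add0r; apply: eqmod_refl.
- by move=> s; rewrite addNr; apply: eqmod_refl.
- by move=> a b s; rewrite scalerA; apply: eqmod_refl.
- by move=> s; rewrite scale1r; apply: eqmod_refl.
- by move=> c s t; rewrite scalerDr; apply: eqmod_refl.
- by move=> a b s; rewrite scalerDl; apply: eqmod_refl.
- by move=> s t u; rewrite commDl; apply: eqmod_refl.
- by move=> s t u; rewrite commDr; apply: eqmod_refl.
- by move=> c s t; rewrite commZl; apply: eqmod_refl.
- by move=> c s t; rewrite commZr; apply: eqmod_refl.
- by move=> s; rewrite /comm subrr; apply: eqmod_refl.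
- by move=> s t u; rewrite comm_jacobi_cyclic; apply: eqmod_refl.
Qed.

Local Notation L := (coeff_lie K B N).

(** A representative is chosen, so this map respects the Lie operations only up to [eqmod]. Together
    with [env_eval] it plays the role of the maps from L and U(L) to the quotient of A by the
    ideal. *)
Definition lie_eval (l : L) : A := lie_term_eval (repr (l : pres_lie (@locality_rel K d B N))).

Lemma lie_eval_class t : eqmod (lie_eval (lie_class _ t)) (lie_term_eval t).
Proof. exact/lie_cong_eval/lie_repr. Qed.

Lemma lie_evalD (l l' : L) : eqmod (lie_eval (l + l')) (lie_eval l + lie_eval l').
Proof.
rewrite /lie_eval; apply: (lie_cong_eval (t := LAdd _ _)); apply/lie_classP.
by rewrite lie_classK lie_classD !lie_classK.
Qed.

Lemma lie_evalZ c (l : L) : eqmod (lie_eval (c *: l)) (c *: lie_eval l).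
Proof.
rewrite /lie_eval; apply: (lie_cong_eval (t := LScale _ _)); apply/lie_classP.
by rewrite lie_classK lie_classZ !lie_classK.
Qed.

Lemma lie_eval_br (l l' : L) :
  eqmod (lie_eval (lie_br l l')) (comm (lie_eval l) (lie_eval l')).
Proof.
rewrite /lie_eval; apply: (lie_cong_eval (t := LBr _ _)); apply/lie_classP.
by rewrite lie_classK lie_class_br !lie_classK.
Qed.

Fixpoint env_term_eval (t : env_term L) : A :=
  match t with
  | EIn l => lie_eval l
  | EZero => 0
  | EOne => 1
  | EOpp s => - env_term_eval s
  | EAdd s u => env_term_eval s + env_term_eval u
  | EScale c s => c *: env_term_eval s
  | EMul s u => env_term_eval s * env_term_eval u
  end.

Lemma env_cong_eval s t : env_cong s t -> eqmod (env_term_eval s) (env_term_eval t).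
Proof.
elim=> {s t} /=.
- exact: lie_evalD.
- exact: lie_evalZ.
- exact: lie_eval_br.
- by move=> t; apply: eqmod_refl.
- by move=> s t _; apply: eqmod_sym.
- by move=> s t u _ H1 _; apply: eqmod_trans.
- by move=> s s' _; apply: eqmodN.
- by move=> s s' t t' _ H1 _; apply: eqmodD.
- by move=> c s s' _; apply: eqmodZ.
- by move=> s s' t t' _ H1 _; apply: eqmodM.
- by move=> s t u; rewrite addrA; apply: eqmod_refl.
- by move=> s t; rewrite addrC; apply: eqmod_refl.
- by move=> s; rewrite add0r; apply: eqmod_refl.
- by move=> s; rewrite addNr; apply: eqmod_refl.
- by move=> a b s; rewrite scalerA; apply: eqmod_refl.
- by move=> s; rewrite scale1r; apply: eqmod_refl.
- by move=> c s t; rewrite scalerDr; apply: eqmod_refl.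
- by move=> a b s; rewrite scalerDl; apply: eqmod_refl.
- by move=> s t u; rewrite mulrA; apply: eqmod_refl.
- by move=> s; rewrite mul1r; apply: eqmod_refl.
- by move=> s; rewrite mulr1; apply: eqmod_refl.
- by move=> s t u; rewrite mulrDl; apply: eqmod_refl.
- by move=> s t u; rewrite mulrDr; apply: eqmod_refl.
- by move=> c s t; rewrite scalerAl; apply: eqmod_refl.
- by move=> c s t; rewrite scalerAr; apply: eqmod_refl.
Qed.

Definition env_eval (e : env_alg L) : A := env_term_eval (repr e).

Lemma env_eval_class t : eqmod (env_eval (env_class t)) (env_term_eval t).
Proof. exact/env_cong_eval/env_repr. Qed.

Section Projection.
Variable pi : A -> env_alg L.
Hypothesis pi_linear : forall (c : K) p q, pi (c *: p + q) = c *: pi p + pi q.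
Hypothesis pi1 : pi 1 = 1.
Hypothesis piM : forall p q, pi (p * q) = pi p * pi q.
Hypothesis pi_gen : forall x, pi (mon [:: x]) = env_in (lie_gen (@locality_rel K d B N) x : L).

Lemma env_eval_proj p : eqmod (env_eval (pi p)) p.
Proof.
have pi0 : pi 0 = 0.
  have := pi_linear (-1) 0 0; rewrite scaler0 addr0 => {1}->.
  by rewrite scaleN1r addNr.
elim: (mon_lspan p) => [|c g q [w _ ->] _ IH].
  by rewrite pi0; apply: (env_eval_class (EZero _)).
rewrite pi_linear -[pi (mon w)]env_classK -[pi q]env_classK -env_classZ -env_classD.
apply: eqmod_trans (env_eval_class _) _ => /=; apply: eqmodD IH; apply: eqmodZ.
elim: w => [|x w IHw].
  by rewrite mon_nil pi1; apply: (env_eval_class (EOne _)).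
rewrite -cat1s -monM piM -[pi (mon w)]env_classK pi_gen -env_classM.
apply: eqmod_trans (env_eval_class _) _ => /=; apply: eqmodM IHw.
exact: (lie_eval_class (LGen x)).
Qed.

(** Applying [env_eval] after [pi] returns [p] modulo the ideal, and [env_eval] sends zero into the
    ideal. *)
Lemma proj_eq0_ideal p : pi p = 0 -> loc_ideal p.
Proof.
move=> p0; have := env_eval_proj p; rewrite p0 => /eqmod_sym/eqmod_trans.
by move/(_ _ (env_eval_class (EZero _))); rewrite /eqmod subr0.
Qed.

End Projection.

Lemma rgen_subF F F' f : {subset F <= F'} ->
  lspan (rgen F (fun _ => True)) f -> lspan (rgen F' (fun _ => True)) f.
Proof.
move=> FF'; apply: lspan_sub => _ [u [x [y [v [bad Fw _ ->]]]]].
apply: lspan_gen; exists u, x, y, v; split=> //.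
by apply: sub_all Fw => z; apply: FF'.
Qed.

Lemma loc_ideal_lspan p : loc_ideal p ->
  exists M cs, lspan (rgen (letters M cs) (fun _ => True)) p.
Proof.
pose G g := exists u x y v, bad_pair N x y /\ g = mon u * rho x y * mon v.
(* Multiplication in the ideal brings in new letters, so the box of letters is chosen only after the
   finite combination is known. *)
suff : loc_ideal p -> lspan G p.
  move=> H /H; elim=> [|c _ q [u [x [y [v [bad ->]]]]] _ [M [cs S]]].
    by exists 0%N, [::]; apply: lspan0.
  have [M1 [cs1 F1]] := letters_cover (u ++ x :: y :: v).
  have [M2 [cs2 [sub1 sub2]]] := letters_join M cs M1 cs1.
  exists M2, cs2; apply: lspanDZ (rgen_subF sub1 S).
  by exists u, x, y, v; split=> //; apply: sub_all F1 => z; apply: sub2.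
elim=> {p} [b a n m||p q _ H1 _|c p _|p q _ H|p q _ H].
- have Grho x y : bad_pair N x y -> lspan G (rho x y).
    move=> bad; apply: lspan_gen; exists [::], x, y, [::]; split=> //.
    by rewrite mon_nil mul1r mulr1.
  by apply: (loc_rel_rho charK N_gt0 (f := fun p => p)) => // bad; apply: Grho.
- exact: lspan0.
- exact: lspanD.
- exact: lspanZ.
- apply: (lspan_map (f := fun r => r * q)) (mon_lspan p) => [|c r s|].
  + by rewrite mul0r.
  + by rewrite mulrDl scalerAl.
  move=> _ [w _ ->]; apply: (lspan_map (f := fun r => mon w * r)) H => [|c r s|].
  + by rewrite mulr0.
  + by rewrite mulrDr scalerAr.
  move=> _ [u [x [y [v [bad ->]]]]]; apply: lspan_gen; exists (w ++ u), x, y, v.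
  by rewrite -monM !mulrA.
apply: (lspan_map (f := fun r => p * r)) (mon_lspan q) => [|c r s|].
+ by rewrite mulr0.
+ by rewrite mulrDr scalerAr.
move=> _ [w _ ->]; apply: (lspan_map (f := fun r => r * mon w)) H => [|c r s|].
+ by rewrite mul0r.
+ by rewrite mulrDl scalerAl.
move=> _ [u [x [y [v [bad ->]]]]]; apply: lspan_gen; exists u, x, y, (v ++ w).
by rewrite -monM !mulrA.
Qed.

Lemma hall_term_indep (r : seq (tree X)) (c : tree X -> K) :
    uniq r -> {in r, forall h, hall_term N h} ->
    loc_ideal (\sum_(h <- r) c h *: tree_comm A h) ->
  {in r, forall h, c h = 0}.
Proof.
move=> ur Tr If h1 h1r; apply/eqP/negPn/negP => ch1.
have Hr : {in r, forall h, hall h} by move=> h /Tr/andP[].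
have [h0 [h0r ch0 coef0 sup _]] := hall_sum_max A ur Hr h1r ch1.
have [M [cs S]] := loc_ideal_lspan If.
have [f0|[W [nt cW supW]]] := ideal_lead_not_terminal charK N_gt0 (@letters_closed _ _ M cs) S.
  by rewrite -coef0 f0 wcoef0 eqxx in ch0.
(* Both [W] and [alpha h0] are the leading word of the same element, but one contains a bad pair and
   the other is terminal. *)
have le1 := sup _ cW; have le2 := supW (alpha h0); rewrite coef0 in le2.
case/predU1P: le1 => [E|lt].
  by have /andP[_] := Tr _ h0r; rewrite -E (negPf nt).
by have := le2 ch0; rewrite wleNgt lt.
Qed.

End LocalityIdeal.

(** * Terminal Hall trees span L *)

Section TerminalSpanning.
Variables (K : fieldType) (d : Order.disp_t) (B : orderType d) (N : nat).
Hypothesis charK : [pchar K] =i pred0.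
Hypothesis N_gt0 : (0 < N)%N.
Local Notation X := (gen B).
Variable A : freeAlgebra K X.
Local Notation mon := (mon A).
Local Notation loc_rel := (loc_rel N mon).
Local Notation rho := (rho N mon).
Local Notation L := (coeff_lie K B N).
Implicit Types (u v w : seq X) (x y z : X) (p r : A) (F : seq X) (t h q : tree X).

Definition lie_tree t : L := tree_eval (@lie_br K L) (lie_gen (@locality_rel K d B N)) t.

(* An element of L is carried along with a preimage in the free algebra, whose
   leading word controls the induction. *)
Definition pair_br (m m' : L * A) : L * A := (lie_br m.1 m'.1, comm m.2 m'.2).

Definition pair_tree t : L * A :=
  tree_eval pair_br (fun x => (lie_gen (@locality_rel K d B N) x : L, mon [:: x])) t.

Lemma pair_treeE t : pair_tree t = (lie_tree t, tree_comm A t).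
Proof. by elim: t => // t1 E1 t2 E2; rewrite /pair_tree /= -!/(pair_tree _) E1 E2. Qed.

Lemma pair_brDl m1 m2 m : pair_br (m1 + m2) m = pair_br m1 m + pair_br m2 m.
Proof. by rewrite /pair_br lie_brDl commDl. Qed.
Lemma pair_brDr m m1 m2 : pair_br m (m1 + m2) = pair_br m m1 + pair_br m m2.
Proof. by rewrite /pair_br lie_brDr commDr. Qed.
Lemma pair_brZl (c : K) m m' : pair_br (c *: m) m' = c *: pair_br m m'.
Proof. by rewrite /pair_br lie_brZl commZl. Qed.
Lemma pair_brZr (c : K) m m' : pair_br m (c *: m') = c *: pair_br m m'.
Proof. by rewrite /pair_br lie_brZr commZr. Qed.
Lemma pair_br_alt m : pair_br m m = 0.
Proof. by rewrite /pair_br lie_br_alt /comm subrr. Qed.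
Lemma pair_br_jacobi m1 m2 m3 : pair_br m1 (pair_br m2 m3) +
  pair_br m2 (pair_br m3 m1) + pair_br m3 (pair_br m1 m2) = 0.
Proof.
by rewrite /pair_br; congr pair; [apply: lie_jacobi|apply: comm_jacobi_cyclic].
Qed.

Section Letters.
Variable F : seq X.
Hypothesis F_closed : closed_letters F.

Definition tree_span : L * A -> Prop :=
  lspan (fun m => exists2 t, all (mem F) (alpha t) & m = pair_tree t).

Lemma tree_span_gen t : all (mem F) (alpha t) -> tree_span (pair_tree t).
Proof. by move=> Ft; apply: lspan_gen; exists t. Qed.

Lemma tree_span_br m m' : tree_span m -> tree_span m' -> tree_span (pair_br m m').
Proof.
move=> Hm Hm'; apply: (lspan_map (f := fun m0 => pair_br m0 m')) Hm => [|c m1 m2|].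
- by have := pair_brZl 0 0 m'; rewrite !scale0r.
- by rewrite pair_brDl pair_brZl.
move=> _ [t Ft ->]; apply: (lspan_map (f := fun m0 => pair_br (pair_tree t) m0)) Hm' => [|c m1 m2|].
- by have := pair_brZr 0 (pair_tree t) 0; rewrite !scale0r.
- by rewrite pair_brDr pair_brZr.
move=> _ [t' Ft' ->]; apply: lspan_gen; exists (Node t t') => //.
by rewrite /= all_cat Ft.
Qed.

Lemma locality_pair b a n m : (0 : L, loc_rel b a n m) =
  \sum_(0 <= s < N.+1) sgnbin K N s *:
    pair_tree (Node (Leaf (mkgen b (n - s%:Z))) (Leaf (mkgen a (m + s%:Z)))).
Proof.
apply: injective_projections.
  rewrite (big_morph (fst : L * A -> L) (id1 := 0) (op1 := +%R)) //=.
  transitivity (lie_class (@locality_rel K d B N) (locality_sum K N b a n m) : L).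
    by apply/esym/lie_classP/LC_rel; exists b, a, n, m.
  rewrite /locality_sum (big_morph _ (@lie_classD _ _ _) (@lie_class0 _ _ _)).
  by apply: eq_bigr => s _; rewrite lie_classZ lie_class_br.
by rewrite (big_morph (snd : L * A -> A) (id1 := 0) (op1 := +%R)).
Qed.

Lemma rho_pair x y : bad_pair N x y -> x \in F -> y \in F -> tree_span (0, rho x y).
Proof.
case: x y => n b [m a] bad Fx Fy; rewrite /rho /=.
set e : K := if _ then _ else _.
have -> : (0, e *: loc_rel b a n m) = e *: (0 : L, loc_rel b a n m).
  by congr pair; rewrite /= scaler0.
apply: lspanZ; rewrite locality_pair; apply: lspan_sum => s.
rewrite mem_index_iota => /andP[_ sN] _; apply: lspanZ; apply: tree_span_gen => /=.
have nm : N%:Z <= n - m by move: bad; rewrite /bad_pair; lia.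
have /andP[Fb _] : (mkgen b (n - s%:Z) \in F) && (mkgen a (n - s%:Z) \in F).
  by apply: F_closed Fx Fy _; lia.
have /andP[_ Fa] : (mkgen b (m + s%:Z) \in F) && (mkgen a (m + s%:Z) \in F).
  by apply: F_closed Fx Fy _; lia.
by rewrite Fb Fa.
Qed.

(** The first coordinate 0 records that the combination of trees giving [p] vanishes in L;
    subtracting it changes the leading word in A and nothing in L. *)
Definition ideal_lead w := exists2 p, tree_span (0, p) & lead F w p.

Lemma ideal_lead_l w h : ideal_lead w -> all (mem F) w -> hall h ->
  all (mem F) (alpha h) -> word_gt (w ++ alpha h) (alpha h ++ w) ->
  ideal_lead (w ++ alpha h).
Proof.
move=> [p Sp Lp] Fw Hh Fh gt; exists (comm p (tree_comm A h)).
  have := tree_span_br Sp (tree_span_gen Fh); rewrite pair_treeE /pair_br /=.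
  suff -> : lie_br (0 : L) (lie_tree h) = 0 by [].
  by have := lie_brZl 0 (0 : L) (lie_tree h); rewrite !scale0r.
by apply: lead_comm => //; apply: tree_comm_lead.
Qed.

Lemma ideal_lead_r w h : ideal_lead w -> all (mem F) w -> hall h ->
  all (mem F) (alpha h) -> word_gt (alpha h ++ w) (w ++ alpha h) ->
  ideal_lead (alpha h ++ w).
Proof.
move=> [p Sp Lp] Fw Hh Fh gt; exists (comm (tree_comm A h) p).
  have := tree_span_br (tree_span_gen Fh) Sp; rewrite pair_treeE /pair_br /=.
  suff -> : lie_br (lie_tree h) (0 : L) = 0 by [].
  by have := lie_brZr 0 (lie_tree h) (0 : L); rewrite !scale0r.
by apply: lead_comm => //; apply: tree_comm_lead.
Qed.

Lemma bad_pair_gt x y : bad_pair N x y -> (y < x)%O.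
Proof.
case: x y => n b [m a] bad; rewrite -[(m, a)]/(mkgen a m) -[(n, b)]/(mkgen b n) gen_lt.
by move: bad; rewrite /bad_pair; lia.
Qed.

(* In [[x, [..[[y, q1], q2] .., qk]]] with [x] larger than all the letters to its
   right, rebracketing to [[..[[x, y], q1] .., qk]] keeps the leading word. *)
Lemma ideal_lead_cons x q y v : bad_pair N x y -> x \in F -> hall q ->
  all (mem F) (alpha q) -> alpha q = y :: v -> ideal_lead (x :: alpha q).
Proof.
move=> bad Fx; elim: q y v bad => [z|q1 IH1 q2 _] y v bad /=.
  move=> _ /andP[Fz _] [zy _]; rewrite zy in Fz *; exists (rho x y).
    exact: rho_pair.
  exact: rho_lead.
move=> /and4P[H1 H2 gt12 _]; rewrite all_cat => /andP[F1 F2].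
case E1: (alpha q1) (alpha_neq0 q1) => [//|y1 v1] _ [yE _].
rewrite -E1 -cat_cons; apply: ideal_lead_l => //.
- by rewrite yE in E1; apply: IH1 bad H1 F1 E1.
- by rewrite /= Fx.
case E2: (alpha q2) (alpha_neq0 q2) => [//|z w] _; apply/orP; left.
move: gt12; rewrite E1 E2 => /word_gt_head zy1.
by rewrite (le_lt_trans zy1) // yE; apply: bad_pair_gt.
Qed.

Lemma ideal_lead_hall h : hall h -> all (mem F) (alpha h) ->
  ~~ terminal N (alpha h) -> ideal_lead (alpha h).
Proof.
elim: h => [//|h1 IH1 h2 IH2] H; rewrite [alpha _]/= all_cat => /andP[F1 F2] nt.
have /and4P[H1 H2 gt12 cond] := H; have swap := hall_Node_swap H.
have [t1|/(IH1 H1 F1) I1] := boolP (terminal N (alpha h1)); last first.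
  exact: ideal_lead_l.
have [t2|/(IH2 H2 F2) I2] := boolP (terminal N (alpha h2)); last first.
  exact: ideal_lead_r.
case E2: (alpha h2) (alpha_neq0 h2) => [//|y v] _.
have [u [x [E1 bad]]] : exists u x, alpha h1 = rcons u x /\ bad_pair N x y.
  case/lastP: (alpha h1) (alpha_neq0 h1) t1 nt => [//|u x] _ t1 nt.
  exists u, x; split=> //; apply/negPn/negP => nbad; case/negP: nt.
  move: t1 t2; rewrite E2 /terminal cat_rcons; case: u => [|z u] /=.
    by rewrite nbad.
  by rewrite rcons_path cat_path /= => /andP[-> ->]; rewrite nbad.
case: h1 => [x'|h3 h4] in H H1 F1 E1 cond {IH1 gt12 swap t1 nt} *.
  move: E1 F1; rewrite /= -[[:: x']]/(rcons [::] x') => /rcons_inj[_ ->]; rewrite andbT -E2 => Fx.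
  by apply: ideal_lead_cons E2.
have /and4P[_ H4 _ _] := H1.
case E4: (alpha h4) (alpha_neq0 h4) => [//|z w] _.
(* A bad pair across the junction excludes a composite left branch: its last letter [x] lies in
   [h4], hence is at most the head [z] of [h4], and the Hall condition gives [z <= y], against
   [y < x]. *)
have zy : (z <= y)%O.
  by case/orP: cond; rewrite E2 E4; [move=> /eqP[-> _]|apply: word_gt_head].
have /allP/(_ x) xz := hall_head_max H4 E4.
have: x \in alpha h4.
  have := mem_last z w; rewrite -[z :: w]E4.
  have -> : last z w = x; last by [].
  have := congr1 (last x) E1; rewrite last_rcons /= last_cat E4 /=.
  by [].
by move/xz => /le_trans /(_ zy); rewrite leNgt bad_pair_gt.
Qed.

Definition term_span : L -> Prop :=
  lspan (fun l => exists2 h, hall_term N h & l = lie_tree h).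

Lemma hall_term_span h : hall h -> all (mem F) (alpha h) -> term_span (lie_tree h).
Proof.
move wE: (alpha h) => w + Fw; elim/wlt_ind: w / Fw h wE => w Fw IH h wE Hh.
have [ht|nt] := boolP (terminal N w).
  by apply: lspan_gen; exists h => //; apply/andP; rewrite wE.
rewrite -wE in nt Fw; have [p Sp Lp] := ideal_lead_hall Hh Fw nt.
(* A single Hall expansion in L x A serves both coordinates: the second one has only words below
   [w], so by [hall_sum_max] every tree with a nonzero coefficient is smaller, and the first
   coordinate then expresses [lie_tree h] through these trees. *)
have := lspanB (tree_span_gen Fw) Sp; rewrite pair_treeE.
have -> : (lie_tree h, tree_comm A h) - (0, p) = (lie_tree h, tree_comm A h - p).
  by congr pair; rewrite /= subr0.
move=> S.
have {S} : lspan (fun m => exists2 t, hall t && all (mem F) (alpha t) & m = pair_tree t)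
    (lie_tree h, tree_comm A h - p).
  apply: lspan_sub S => _ [t Ft ->].
  exact: (hall_spanning _ pair_brDl pair_brDr pair_brZl pair_brZr pair_br_alt
    pair_br_jacobi Ft).
case/lspan_repr => s [c [us Ps]] E.
have E1 : lie_tree h = \sum_(t <- s) c t *: lie_tree t.
  have := congr1 fst E; rewrite /= (big_morph (fst : L * A -> L) (id1 := 0) (op1 := +%R)) // => ->.
  by apply: eq_bigr => t _; rewrite pair_treeE.
have E2 : tree_comm A h - p = \sum_(t <- s) c t *: tree_comm A t.
  have := congr1 snd E; rewrite /= (big_morph (snd : L * A -> A) (id1 := 0) (op1 := +%R)) // => ->.
  by apply: eq_bigr => t _; rewrite pair_treeE.
have low : supp_in (fun v => wlt v w) (tree_comm A h - p).
  have := supp_inB (tree_comm_lead (A := A) Hh Fw) Lp; rewrite opprB addrA subrK.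
  by apply: supp_in_sub => v /andP[_]; rewrite wE.
rewrite E1; apply: lspan_sum => t ts _; have [->|ct] := eqVneq (c t) 0.
  by rewrite scale0r; apply: lspan0.
have Hs : {in s, forall t', hall t'} by move=> t' /Ps/andP[].
have [h0 [h0s ch0 coef0 _ hmax]] := hall_sum_max A us Hs ts ct.
apply: lspanZ; have /andP[Ht Ft] := Ps _ ts.
apply: IH (erefl (alpha t)) Ht => //.
apply: wle_lt_trans (hmax _ ts ct) _; apply: low.
by rewrite E2 coef0.
Qed.

End Letters.

Lemma term_span_tree t : term_span (lie_tree t).
Proof.
have [M [cs Ft]] := letters_cover (alpha t).
have S := hall_spanning (lie_gen (@locality_rel K d B N) : X -> L) (@lie_brDl K L)
  (@lie_brDr K L) (@lie_brZl K L) (@lie_brZr K L) (@lie_br_alt K L) (@lie_jacobi K L) Ft.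
apply: lspan_sub S => _ [h /andP[Hh Fh] ->].
exact: hall_term_span (@letters_closed _ _ M cs) _ Hh Fh.
Qed.

Lemma term_span_all (l : L) : term_span l.
Proof.
suff: lspan (fun l => exists t, l = lie_tree t) l.
  by apply: lspan_sub => _ [t ->]; apply: term_span_tree.
rewrite -[l]lie_classK; elim: (repr _) => [x||s IH|s IHs u IHu|c s IH|s IHs u IHu].
- by apply: lspan_gen; exists (Leaf x).
- exact: lspan0.
- by rewrite lie_classN; apply: lspanN.
- by rewrite lie_classD; apply: lspanD.
- by rewrite lie_classZ; apply: lspanZ.
rewrite lie_class_br; set ls := lie_class _ s in IHs *; set lu := lie_class _ u in IHu *.
apply: (lspan_map (f := fun m => lie_br m (lu : L))) IHs => [|k m1 m2|].
- by have := lie_brZl 0 (0 : L) lu; rewrite !scale0r.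
- by rewrite lie_brDl lie_brZl.
move=> _ [t ->]; apply: (lspan_map (f := fun m => lie_br (lie_tree t) (m : L))) IHu => [|k m1 m2|].
- by have := lie_brZr 0 (lie_tree t) (0 : L); rewrite !scale0r.
- by rewrite lie_brDr lie_brZr.
by move=> _ [t' ->]; apply: lspan_gen; exists (Node t t').
Qed.

End TerminalSpanning.

(** * The free algebra K<X> *)

Lemma malg_scaleAr (K : comNzRingType) (M : monomType) (c : K) (p q : {malg K[M]}) :
  c *: (p * q) = p * (c *: q).
Proof.
have pC : p * c%:MP = c%:MP * p.
  rewrite !malgM_def fgmulgU fgmulUg; apply: eq_bigr => k _.
  by rewrite mulm1 mul1m mulrC.
by rewrite -!mul_malgC !mulrA pC.
Qed.

HB.instance Definition _ (K : fieldType) (d : Order.disp_t) (B : orderType d) :=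
  GRing.Lalgebra_isAlgebra.Build K (free_alg K B) (@malg_scaleAr K {fmonom gen B}).

Section FreeMonoidAlgebra.
Variables (K : fieldType) (T : choiceType).
Local Notation A := {malg K[{fmonom T}]}.
Implicit Types (u v w : seq T) (p q : A).

Lemma malg_mon_nil : << FMonom [::] >> = 1 :> A.
Proof. by congr (<< _ >>); apply/eqP; rewrite -val_eqE /= fm1. Qed.

Lemma malg_monM u v : << FMonom u >> * << FMonom v >> = << FMonom (u ++ v) >> :> A.
Proof.
rewrite malgM_def fgmulUU mulr1; congr (<< _ >>).
by apply/eqP; rewrite -val_eqE /= fmM.
Qed.

Lemma malg_coefP w c p q : (c *: p + q)@_(FMonom w) = c * p@_(FMonom w) + q@_(FMonom w).
Proof. by rewrite mcoeffD mcoeffZ. Qed.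

Lemma malg_coef_mon w v : (<< FMonom v >> : A)@_(FMonom w) = (v == w)%:R.
Proof. exact: mcoeffU. Qed.

Lemma malg_mon_lspan p :
  lspan (fun q => exists2 w, p@_(FMonom w) != 0 & q = << FMonom w >>) p.
Proof.
rewrite {2}[p]monalgE; apply: lspan_sum => -[w] wp _.
have -> : << p@_(FMonom w) *g FMonom w >> = p@_(FMonom w) *: (<< FMonom w >> : A).
  by apply/malgP => k; rewrite [RHS]mcoeffZ [LHS]mcoeffU mcoeffU mulr_natr.
by apply: lspanZ; apply: lspan_gen; exists w; rewrite // mcoeff_neq0.
Qed.

End FreeMonoidAlgebra.

Definition free_alg_free (K : fieldType) (d : Order.disp_t) (B : orderType d) :
    freeAlgebra K (gen B) :=
  @FreeAlgebra K (gen B) (free_alg K B) (fun w => << FMonom w >>)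
    (fun w => mcoeff (FMonom w)) (@malg_mon_nil K (gen B)) (@malg_monM K (gen B))
    (@malg_coefP K (gen B)) (@malg_coef_mon K (gen B)) (@malg_mon_lspan K (gen B)).

(** * Independence in U(L), embedding of L, and the basis *)

Section Main.
Variables (K : fieldType) (d : Order.disp_t) (B : orderType d) (N : nat).
Local Notation X := (gen B).
Local Notation L := (coeff_lie K B N).
Local Notation A := (free_alg_free K B).

Lemma lambdaE (t : tree X) : lambda K t = tree_comm A t.
Proof. by elim: t => [x|t1 IH1 t2 IH2] /=; [rewrite fmuE|rewrite IH1 IH2]. Qed.

Lemma phiB (p q : free_alg K B) : phi N (p - q) = phi N p - phi N q.
Proof. by rewrite -scaleN1r addrC phi_linear scaleN1r addrC. Qed.

Lemma phi_lambda (t : tree X) : phi N (lambda K t) = env_in (lie_tree K N t).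
Proof.
elim: t => [x|t1 IH1 t2 IH2]; first exact: phi_gen.
have [_ phiM] := phi_monoid_morphism K B N.
transitivity (phi N (lambda K t1) * phi N (lambda K t2) -
              phi N (lambda K t2) * phi N (lambda K t1)).
  by apply: etrans (phiB _ _) _; congr (_ - _); apply: phiM.
by rewrite IH1 IH2 -env_in_br.
Qed.

Lemma env_in_sum (I : Type) (r : seq I) (c : I -> K) (l : I -> L) :
  env_in (\sum_(i <- r) c i *: l i) = \sum_(i <- r) c i *: env_in (l i).
Proof.
elim: r => [|i r IH]; rewrite ?big_nil ?big_cons; last by rewrite env_inD env_inZ IH.
by have := env_inZ 0 (0 : L); rewrite !scale0r.
Qed.

Lemma phi_sum (I : Type) (r : seq I) (c : I -> K) (p : I -> free_alg K B) :
  phi N (\sum_(i <- r) c i *: p i) = \sum_(i <- r) c i *: phi N (p i).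
Proof.
elim: r => [|i r IH]; rewrite ?big_nil ?big_cons; last by rewrite phi_linear IH.
by have := phiB 0 0; rewrite !subrr.
Qed.

Hypothesis charK : [pchar K] =i pred0.
Hypothesis N_gt0 : (0 < N)%N.

Lemma env_in_indep (r : seq (tree X)) (c : tree X -> K) :
    uniq r -> {in r, forall h, hall_term N h} ->
    \sum_(h <- r) c h *: env_in (lie_tree K N h) = 0 ->
  {in r, forall h, c h = 0}.
Proof.
move=> ur Tr sum0; apply: (hall_term_indep (A := A) charK N_gt0 ur Tr).
have [phi1 phiM] := phi_monoid_morphism K B N.
apply: (@proj_eq0_ideal K d B N A (@phi K d B N)).
- exact: phi_linear.
- exact: phi1.
- exact: phiM.
- by move=> x; rewrite -phi_gen fmuE.
rewrite -[RHS]sum0.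
transitivity (phi N (\sum_(h <- r) c h *: lambda K h)).
  apply: congr1; apply: eq_bigr => h _.
  exact: (congr1 (GRing.scale (c h)) (esym (lambdaE h))).
by rewrite phi_sum; apply: eq_bigr => h _; rewrite phi_lambda.
Qed.

Lemma hall_term_lspan (l : L) : exists r (c : tree X -> K),
  [/\ uniq r, {in r, forall h, hall_term N h} & l = \sum_(h <- r) c h *: lie_tree K N h].
Proof. exact/lspan_repr/(term_span_all charK N_gt0 A). Qed.

Lemma env_in_inj : injective (@env_in K L).
Proof.
move=> l l' E; apply/eqP; rewrite -subr_eq0; apply/eqP.
have [r [c [ur Tr lE]]] := hall_term_lspan (l - l').
have c0 : {in r, forall h, c h = 0}.
  apply: env_in_indep => //; rewrite -env_in_sum -lE -scaleN1r addrC.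
  by rewrite env_inD env_inZ E scaleN1r addNr.
by rewrite lE big_seq big1 // => h /c0->; rewrite scale0r.
Qed.

End Main.

Local Open Scope classical_set_scope.

(** The elements [phi (lambda h)] live in U(L), whereas the basis is claimed in L. The set is
    therefore shown to lie in the image of L, and its full preimage to be a basis; [env_in_inj]
    ensures that the preimage has no further elements. *)
Theorem mainTheorem2 (K : fieldType) (d : Order.disp_t) (B : orderType d)
    (N : nat) (charK : [pchar K] =i pred0) (N_gt0 : (0 < N)%N) :
  let L : lieAlgType K := coeff_lie K B N in
  let S : set (env_alg L) :=
    [set phi N p | p in [set lambda K h | h in hall_term (B := B) N]] in
  S `<=` range (env_in (L := L)) /\ is_basis (env_in (L := L) @^-1` S).
Proof.
move=> L S.
have inS h : hall_term N h -> S (env_in (lie_tree K N h)).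
  by move=> Th; exists (lambda K h); [exists h|exact: phi_lambda].
have SE e : S e -> exists2 h, hall_term N h & e = env_in (lie_tree K N h).
  by case=> _ [h Th <-] <-; exists h => //; exact: phi_lambda.
split; first by move=> e /SE[h _ ->]; exists (lie_tree K N h).
split=> [s c us sS sum0|l]; last first.
  have [|s [c [_ sS ->]]] := @lspan_repr K L L id (fun l => S (env_in l)) l.
    apply: lspan_sub (term_span_all charK N_gt0 (free_alg_free K B) l) => _ [h Th ->].
    by apply: lspan_gen; exists (lie_tree K N h) => //; apply: inS.
  by exists s, c.
(* Independence is known for families indexed by trees, so the list of vectors is lifted to terminal
   Hall trees; the lift has no repetition because [s] has none. *)
have [r rs Tr] : exists2 r, [seq lie_tree K N h | h <- r] = s &
    {in r, forall h, hall_term N h}.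
  elim: s {us sum0} sS => [_|v s IH sS]; first by exists [::].
  have [|r rs Tr] := IH; first by move=> u us; apply: sS; rewrite inE us orbT.
  have [h Th /(env_in_inj charK N_gt0) vE] := SE _ (sS v (mem_head _ _)).
  exists (h :: r); rewrite /= ?rs ?vE // => g.
  by rewrite inE => /predU1P[->|/Tr].
have ur : uniq r by apply: (@map_uniq _ _ (lie_tree K N)); rewrite rs.
have c0 : {in r, forall h, c (lie_tree K N h) = 0}.
  apply: (env_in_indep charK N_gt0 (c := fun h => c (lie_tree K N h)) ur Tr).
  rewrite -env_in_sum -(big_map _ xpredT (fun v => c v *: v)) rs sum0.
  by have := env_inZ 0 (0 : L); rewrite !scale0r.
by move=> v; rewrite -rs => /mapP[h hr ->]; apply: c0.
Qed.
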